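(* Let $\mathbb{G}$ be a Green kernel of type $(s,\gamma)$ on $\Omega$ with Green operator $\mathcal{G}$, admitting a $\gamma$-normal derivative $D_\gamma\mathbb{G}$. For $j\in\mathbb{N}$ (large enough that the set below is nonempty) let $A_j=\{x\in\Omega:1/j<\delta(x)<2/j\}$ and $$f_j=\frac{|\partial\Omega|\,\chi_{A_j}}{|A_j|\,\delta^\gamma},$$ so that $\|f_j\delta^\gamma\|_{L^1(\Omega)}=|\partial\Omega|$. Then there exists a function $u^\star\in L^1_{loc}(\Omega)$ such that $$\mathcal{G}(f_j)\rightharpoonup u^\star\quad\text{weakly in }L^1(K)\text{ as }j\to\infty,\text{ for every }K\Subset\Omega.$$ Furthermore, $u^\star$ satisfies $$\int_\Omega u^\star\psi=\int_{\partial\Omega}D_\gamma\big(\mathcal{G}(\psi)\big)(z)\,dz\qquad\text{for any }\psi\in L^\infty_c(\Omega),$$ and is given by $$u^\star(x)=\int_{\partial\Omega}D_\gamma\mathbb{G}(z,x)\,dz.$$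
   Context: $\Omega\subset\mathbb{R}^n$ ($n\ge1$) is a bounded domain with $C^{1,1}$ boundary and $\delta(x)=\mathrm{dist}(x,\partial\Omega)$. Write $a\wedge b=\min\{a,b\}$. For nonnegative functions, $f\asymp g$ on a set means that there is a constant $C>0$ with $C^{-1}g\le f\le Cg$ on that set. $L^\infty_c(\Omega)$ is the space of bounded measurable functions with compact support in $\Omega$; $K\Subset\Omega$ means $K$ is a compact subset of $\Omega$. $|A_j|$ is Lebesgue measure; $dz$ on $\partial\Omega$ is surface measure and $|\partial\Omega|$ its total mass (counting measure if $n=1$). Pointwise identities between $L^1_{loc}$ functions are understood a.e. A Green kernel of type $(s,\gamma)$ on $\Omega$, where $s,\gamma\in(0,1]$ and $2s\le n$, is a measurable function $\mathbb{G}:\Omega\times\Omega\to\mathbb{R}$ such that $\mathbb{G}(x,y)=\mathbb{G}(y,x)$ and $$\mathbb{G}(x,y)\asymp\frac{1}{|x-y|^{n-2s}}\Big(\frac{\delta(x)\delta(y)}{|x-y|^2}\wedge1\Big)^\gamma,\qquad x,y\in\Omega,\ x\ne y.$$ Its Green operator is $\mathcal{G}(f)(x)=\int_\Omega\mathbb{G}(x,y)f(y)\,dy$. $\mathbb{G}$ admits a $\gamma$-normal derivative if there exists a (measurable) function $D_\gamma\mathbb{G}:\partial\Omega\times\Omega\to\mathbb{R}$ such that for every $z\in\partial\Omega$ and every sequence $x_j\in\Omega$ with $x_j\to z$ one has $\lim_j\mathbb{G}(x_j,\cdot)/\delta(x_j)^\gamma=D_\gamma\mathbb{G}(z,\cdot)$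 a.e. in $\Omega$. For a function $u$ on $\Omega$, $D_\gamma u(z)=\lim_{x\to z,\,x\in\Omega}u(x)/\delta(x)^\gamma$ for $z\in\partial\Omega$; this limit exists when $u=\mathcal{G}(\psi)$ with $\psi\in L^\infty_c(\Omega)$. *)

(* Defs.v *)
From HB Require Import structures.
From mathcomp Require Import all_boot all_order all_algebra.
From mathcomp Require Import all_classical all_reals all_analysis.
Set Implicit Arguments.
Unset Strict Implicit.
Unset Printing Implicit Defensive.
Import Order.TTheory GRing.Theory Num.Theory.
Import numFieldNormedType.Exports.

Local Open Scope classical_set_scope.
Local Open Scope ring_scope.

(* The sigma-algebra on R^n generated by the coordinates, i.e. the Borel
   sigma-algebra.  It is set up as the library does for n.-tuple. *)
Definition measure_rV_display : measure_display -> measure_display.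
Proof. exact. Qed.

Section measurable_rV.
Context {d} {T : sigmaRingType d}.
Variable n : nat.

Let coors : 'I_n -> 'rV[T]_n -> T := fun i x => x ord0 i.

Let rV_set0 : g_sigma_preimage coors set0.
Proof. exact: sigma_algebra0. Qed.

Let rV_setC A : g_sigma_preimage coors A -> g_sigma_preimage coors (~` A).
Proof. exact: sigma_algebraC. Qed.

Let rV_bigcup (F : (set 'rV[T]_n)^nat) :
  (forall i, g_sigma_preimage coors (F i)) ->
  g_sigma_preimage coors (\bigcup_i (F i)).
Proof. exact: sigma_algebra_bigcup. Qed.

HB.instance Definition _ := @isMeasurable.Build (measure_rV_display d)
  'rV[T]_n (g_sigma_preimage coors) rV_set0 rV_setC rV_bigcup.

End measurable_rV.

Lemma measurable_fun_rVP d1 d2 (T1 : measurableType d1) (T2 : measurableType d2)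
    n (f : T1 -> 'rV[T2]_n) :
  (forall i, measurable_fun [set: T1] (fun x => f x ord0 i)) ->
  measurable_fun [set: T1] f.
Proof.
move=> mf.
suff : g_sigma_preimage (fun (i : 'I_n) (x : T1) => f x ord0 i) `<=` measurable.
  rewrite (_ : (fun i x => f x ord0 i) =
      (fun i => (fun v : 'rV[T2]_n => v ord0 i) \o f))//.
  by rewrite g_sigma_preimage_comp => prefS _ A mA; apply: prefS; exists A.
apply: smallest_sub; first exact: sigma_algebra_measurable.
case: n => [|n] in f mf *; first by rewrite big_ord0.
rewrite -bigcup_mkord_ord; apply: bigcup_sub => i Ii.
by move=> A [B mB <-]; exact: mf.
Qed.

Lemma measurable_coord d (T : measurableType d) n (i : 'I_n) :
  measurable_fun [set: 'rV[T]_n] (fun x => x ord0 i).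
Proof.
move=> _ Y mY; rewrite setTI; apply: sub_sigma_algebra => /=.
rewrite -bigcup_seq/=; exists i => /=; first by rewrite mem_index_enum.
by exists Y => //; rewrite setTI.
Qed.

Section lebesgue_rV.
Context {R : realType}.

Definition cons_rV n (t : R) (y : 'rV[R]_n) : 'rV[R]_n.+1 :=
  row_mx (t%:M : 'rV[R]_1) y.

(* n-dimensional Lebesgue measure by iterated integration; R^0 has mass 1. *)
Fixpoint lebesgue_rV (n : nat) : set 'rV[R]_n -> \bar R :=
  match n with
  | 0 => fun A => \d_(0 : 'rV[R]_0) A
  | n'.+1 => fun A =>
      (\int[@lebesgue_measure R]_t lebesgue_rV [set y | A (cons_rV t y)])%E
  end.

Lemma measurable_cons_rV n :
  measurable_fun [set: measurableTypeR R * 'rV[R]_n] (fun p => cons_rV p.1 p.2).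
Proof.
apply: measurable_fun_rVP => i; rewrite /cons_rV.
have [j ->|j ->] := split_ordP (i : 'I_(1 + n)).
  rewrite (_ : (fun _ => _) = fst)//.
  apply/funext => -[t y]; rewrite [LHS]row_mxEl.
  by rewrite mxE (ord1 j) eqxx mulr1n.
rewrite (_ : (fun _ => _) = (fun v : 'rV[R]_n => v ord0 j) \o snd); last first.
  by apply/funext => -[t y]; rewrite [LHS]row_mxEr.
by apply: measurableT_comp => //; exact: measurable_coord.
Qed.

Definition uncons_rV n (v : 'rV[R]_n.+1) : R * 'rV[R]_n :=
  (v ord0 ord0, rsubmx (v : 'rV[R]_(1 + n))).

Lemma cons_rVK n (p : R * 'rV[R]_n) : uncons_rV (cons_rV p.1 p.2) = p.
Proof.
case: p => t y; rewrite /uncons_rV /cons_rV; congr (_, _); last exact: row_mxKr.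
rewrite (_ : ord0 = lshift n (ord0 : 'I_1)); last exact: val_inj.
by rewrite [LHS]row_mxEl mxE eqxx mulr1n.
Qed.

Lemma measurable_uncons_rV n :
  measurable_fun [set: 'rV[R]_n.+1]
    (@uncons_rV n : _ -> measurableTypeR R * 'rV[R]_n).
Proof.
apply: measurable_fun_pair; first exact: measurable_coord.
apply: measurable_fun_rVP => i.
rewrite (_ : (fun _ => _) = fun v : 'rV[R]_n.+1 => v ord0 (rshift 1 i)).
  exact: measurable_coord.
by apply/funext => v; rewrite mxE.
Qed.

Section lebesgue_rV_succ.
Variables (n : nat) (mu : {sigma_finite_measure set 'rV[R]_n -> \bar R}).

Let nu := [the {measure set _ -> \bar R} of (@lebesgue_measure R \x mu)%E].

Let nu_sigma_finite : sigma_finite setT nu.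
Proof.
have /sigma_finiteP[F [TF ndF Foo]] := sigma_finiteT (@lebesgue_measure R).
have /sigma_finiteP[G [TG ndG Goo]] := sigma_finiteT mu.
exists (fun k => F k `*` G k).
  rewrite -setXTT TF TG predeqE => -[x y]; split.
    move=> [/= [k _ Fkx] [l _ Gly]]; exists (maxn k l) => //; split.
    - by move: x Fkx; exact/subsetPset/ndF/leq_maxl.
    - by move: y Gly; exact/subsetPset/ndG/leq_maxr.
  by move=> [k _ []/= ? ?]; split; exists k.
move=> k; have [? ?] := Foo k; have [? ?] := Goo k.
split; first exact: measurableX.
by rewrite [ltLHS]product_measure1E// lte_mul_pinfty// ge0_fin_numE.
Qed.

Let succ := pushforward nu (fun p => cons_rV p.1 p.2).

Let succ0 : succ set0 = 0%E.
Proof. by rewrite /succ /pushforward preimage_set0 measure0. Qed.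

Let mpre A : measurable A ->
  measurable ((fun p : measurableTypeR R * 'rV[R]_n => cons_rV p.1 p.2) @^-1` A).
Proof. by move=> mA; rewrite -[X in measurable X]setTI; exact: measurable_cons_rV. Qed.

Let succ_ge0 A : (0 <= succ A)%E.
Proof. by rewrite /succ /pushforward; exact: (measure_ge0 nu). Qed.

Let succ_sigma_additive : semi_sigma_additive succ.
Proof.
move=> F mF tF mUF; rewrite /succ /pushforward preimage_bigcup.
apply: measure_semi_sigma_additive.
- by move=> k; exact: mpre.
- apply/trivIsetP => /= i j _ _ ij; rewrite -preimage_setI.
  by move/trivIsetP : tF => /(_ _ _ _ _ ij) ->//; rewrite preimage_set0.
- by rewrite -preimage_bigcup; exact: mpre.
Qed.

HB.instance Definition _ :=
  isMeasure.Build _ _ _ succ succ0 succ_ge0 succ_sigma_additive.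

Let succ_sigma_finite : sigma_finite setT succ.
Proof.
have [F FT Foo] := nu_sigma_finite.
exists (fun k => @uncons_rV n @^-1` F k).
  by rewrite -preimage_bigcup -FT preimage_setT.
move=> k; have [mF Fk] := Foo k; split.
  by rewrite -[X in measurable X]setTI; exact: measurable_uncons_rV.
rewrite /succ /pushforward -comp_preimage.
rewrite (_ : @uncons_rV n \o _ = id)//.
by apply/funext => p /=; rewrite cons_rVK.
Qed.

HB.instance Definition _ :=
  Measure_isSigmaFinite.Build _ _ _ succ succ_sigma_finite.

Definition lebesgue_rV_succ : {sigma_finite_measure set _ -> \bar R} := succ.

Lemma lebesgue_rV_succE A :
  (lebesgue_rV_succ A =
   \int[@lebesgue_measure R]_t mu [set y | A (cons_rV t y)])%E.
Proof.
rewrite /lebesgue_rV_succ /= /succ /pushforward /nu /product_measure1.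
apply: eq_integral => t _ /=; congr (mu _).
by apply/funext => y; rewrite /xsection /= -[RHS]asboolE.
Qed.

End lebesgue_rV_succ.

Lemma lebesgue_rV_sigma_finite_measure n :
  exists mu : {sigma_finite_measure set 'rV[R]_n -> \bar R},
    @lebesgue_rV n = mu :> (set _ -> \bar R).
Proof.
elim: n => [|n [mu IH]].
  by exists [the {sigma_finite_measure set _ -> \bar R} of \d_(0 : 'rV[R]_0)].
exists (lebesgue_rV_succ mu); apply/funext => A.
by rewrite lebesgue_rV_succE /= IH.
Qed.

Section lebesgue_rV_instance.
Variable n : nat.

Let lebesgue_rV0 : @lebesgue_rV n set0 = 0%E.
Proof. by have [mu ->] := lebesgue_rV_sigma_finite_measure n. Qed.

Let lebesgue_rV_ge0 A : (0 <= @lebesgue_rV n A)%E.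
Proof. by have [mu ->] := lebesgue_rV_sigma_finite_measure n. Qed.

Let lebesgue_rV_sigma_additive : semi_sigma_additive (@lebesgue_rV n).
Proof.
have [mu ->] := lebesgue_rV_sigma_finite_measure n.
exact: measure_semi_sigma_additive.
Qed.

HB.instance Definition _ := isMeasure.Build _ _ _ (@lebesgue_rV n)
  lebesgue_rV0 lebesgue_rV_ge0 lebesgue_rV_sigma_additive.

Let lebesgue_rV_sigma_finite : sigma_finite setT (@lebesgue_rV n).
Proof.
have [mu ->] := lebesgue_rV_sigma_finite_measure n; exact: sigma_finiteT.
Qed.

HB.instance Definition _ :=
  Measure_isSigmaFinite.Build _ _ _ (@lebesgue_rV n) lebesgue_rV_sigma_finite.

End lebesgue_rV_instance.

End lebesgue_rV.

Arguments lebesgue_rV {R} n.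

Section euclidean.
Context {R : realType} {n : nat}.
Implicit Types (x y : 'rV[R]_n) (A : set 'rV[R]_n).

(* The norm of the library on 'rV[R]_n is the max-norm. *)
Definition enorm x : R := Num.sqrt (\sum_(i < n) x ord0 i ^+ 2).

Definition eball x (r : R) : set 'rV[R]_n := [set y | enorm (y - x) < r].

Definition boundary A : set 'rV[R]_n := closure A `\` interior A.

Definition edist A x : R := inf [set enorm (x - y) | y in A].

Definition bdist A x : R := edist (boundary A) x.

End euclidean.

Section surface.
Context {R : realType} {m : nat}.
Implicit Types (Om : set 'rV[R]_m.+1) (phi : 'rV[R]_m -> R).

Definition grad phi (y : 'rV[R]_m) : 'rV[R]_m :=
  \row_(i < m) 'D_(delta_mx ord0 i) phi y.

Definition C11 phi :=
  (forall y, differentiable phi y) /\ exists k : R, k.-lipschitz (grad phi).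

(* Inside the ball of centre c and radius r, Om is the region above the graph
   of phi: (x - c) *m Q are the coordinates of x in a rotated or reflected
   orthonormal frame with origin c, and the zeroth of them is the one in the
   direction of which the graph is taken. *)
Definition graph_chart Om (c : 'rV[R]_m.+1) (r : R) (Q : 'M[R]_m.+1) phi :=
  [/\ 0 < r, Q *m Q^T = 1%:M, C11 phi &
    forall x, eball c r x ->
      (Om x <-> let p := uncons_rV ((x - c) *m Q) in phi p.2 < p.1)].

Definition bounded_C11_domain Om :=
  [/\ Om !=set0, open Om, connected Om, bounded_set Om &
    forall z, boundary Om z -> exists r Q phi, graph_chart Om z r Q phi].

Definition graph_point (c : 'rV[R]_m.+1) (Q : 'M[R]_m.+1) phi (y : 'rV[R]_m) :=
  c + cons_rV (phi y) y *m Q^T.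

(* The surface measure of the boundary, as a measure on R^(m+1): it is carried
   by the boundary and has the usual area element
   sqrt (1 + |grad phi|^2) dy in every local graph representation.  The boundary
   being covered by countably many of these, at most one measure is such.  For
   m = 0, the parameter space R^0 has mass 1 and this is the counting measure
   of the boundary. *)
Definition surface_measure Om (sigma : {measure set 'rV[R]_m.+1 -> \bar R}) :=
  sigma (~` boundary Om) = 0%E /\
  forall c r Q phi, graph_chart Om c r Q phi ->
    forall B, measurable B -> B `<=` eball c r ->
      sigma B = (\int[lebesgue_rV m]_(y in graph_point c Q phi @^-1` B)
                   (Num.sqrt (1 + enorm (grad phi y) ^+ 2))%:E)%E.

End surface.

Section green.
Context {R : realType} {n : nat}.
Local Notation T := 'rV[R]_n.
Implicit Types (Om K : set T) (G D : T -> T -> R) (f u psi : T -> R).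

Definition green_profile Om (s gamma : R) (x y : T) : R :=
  (enorm (x - y) `^ (n%:R - 2 * s))^-1 *
  Num.min (bdist Om x * bdist Om y / enorm (x - y) ^+ 2) 1 `^ gamma.

Definition green_kernel Om (s gamma : R) G :=
  [/\ 0 < s <= 1, 0 < gamma <= 1 & 2 * s <= n%:R] /\
  [/\ measurable_fun (Om `*` Om) (fun p : T * T => G p.1 p.2),
      forall x y, Om x -> Om y -> G x y = G y x &
      exists C : R, 0 < C /\ forall x y, Om x -> Om y -> x != y ->
        C^-1 * green_profile Om s gamma x y <= G x y
          <= C * green_profile Om s gamma x y].

Definition green_operator Om G f (x : T) : R :=
  (\int[lebesgue_rV n]_(y in Om) (G x y * f y))%R.

(* D is the gamma-normal derivative of G, with the boundary variable first. *)
Definition kernel_normal_derivative Om (gamma : R) G D :=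
  measurable_fun (boundary Om `*` Om) (fun p : T * T => D p.1 p.2) /\
  forall z, boundary Om z ->
  forall x_ : nat -> T, (forall j, Om (x_ j)) -> x_ j @[j --> \oo] --> z ->
    {ae lebesgue_rV n, forall y, Om y ->
      G (x_ j) y / bdist Om (x_ j) `^ gamma @[j --> \oo] --> D z y}.

Definition normal_quotient Om (gamma : R) u (x : T) : R :=
  u x / bdist Om x `^ gamma.

Definition has_normal_derivative Om (gamma : R) u (z : T) :=
  cvg (normal_quotient Om gamma u x @[x --> within Om (nbhs z)]).

Definition normal_derivative Om (gamma : R) u (z : T) : R :=
  lim (normal_quotient Om gamma u x @[x --> within Om (nbhs z)]).

Definition L1 K f := (lebesgue_rV n).-integrable K (EFin \o f).

Definition L1loc Om f := forall K, compact K -> K `<=` Om -> L1 K f.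

Definition Linf K f :=
  measurable_fun K f /\
  exists M : R, {ae lebesgue_rV n, forall x, K x -> `|f x| <= M}.

Definition Linfc Om psi :=
  [/\ measurable_fun Om psi, exists M : R, forall x, Om x -> `|psi x| <= M &
    exists2 K, compact K /\ K `<=` Om &
      forall x, Om x -> ~ K x -> psi x = 0].

Definition weak_L1_cvg K (u_ : nat -> T -> R) u :=
  [/\ \forall j \near \oo, L1 K (u_ j), L1 K u &
    forall g, Linf K g ->
      (\int[lebesgue_rV n]_(x in K) (u_ j x * g x)%:E)%E @[j --> \oo] -->
      (\int[lebesgue_rV n]_(x in K) (u x * g x)%:E)%E].

Definition layer Om (j : nat) : set T :=
  [set x | Om x /\ j%:R^-1 < bdist Om x < 2 / j%:R].

Definition layer_fun Om (sigma : set T -> \bar R) (gamma : R) (j : nat) (x : T) :=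
  fine (sigma (boundary Om)) * \1_(layer Om j) x /
  (fine (lebesgue_rV n (layer Om j)) * bdist Om x `^ gamma).

End green.

(* Main.v *)
(* Let psi be supported in a compact set K.  By Fubini and the symmetry of G,
   the pairing of G(f_j) with psi is |bd Om| / |A_j| times the integral over A_j
   of the quotient G(psi) / delta^gamma.  As K has a positive distance to the
   boundary, the Green bounds make this quotient bounded near the boundary, and
   by dominated convergence it extends continuously there by the integral of
   D(z, y) psi(y) dy.  Everything is thus reduced to the fact that j times
   Lebesgue measure on A_j converges to the surface measure, tested against
   bounded functions with boundary values.  A finite partition localizes this to
   a C^{1,1} chart, where one rescales the distance to the graph of phi: at
   (phi y + tau / j, y), j delta tends to tau / sqrt (1 + |grad phi y|^2), so
   A_j becomes an interval in tau whose length is the area element.  Applied to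
   1, this gives j |A_j| -> |bd Om|; Fubini on the boundary side identifies
   the limit with the pairing of u* and psi. *)

From HB Require Import structures.
Require Import Defs.
From mathcomp Require Import all_boot all_order all_algebra.
From mathcomp Require Import all_classical all_reals all_analysis.
From mathcomp Require Import measurable_realfun ring lra.
Set Implicit Arguments.
Unset Strict Implicit.
Unset Printing Implicit Defensive.
Import Order.TTheory GRing.Theory Num.Theory.
Import numFieldNormedType.Exports.
Local Open Scope classical_set_scope.
Local Open Scope ring_scope.

(** * Euclidean norm and distance to the boundary *)

(** Lebesgue measure is built by iterated integration, so its rotation invariance, on which every
    chart rests, has to be derived: it comes from a uniqueness argument for translation-invariant
    measures. What else a chart map does is an affine change of one variable on each fibre over y,
    which takes the place of a Jacobian formula. Surface integrals are moved to the same space of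
    pairs (tau, y) as the rescaled layer integrals, so that dominated convergence compares the two;
    pointwise convergence can fail only on two graphs in that space, which are null. The kernel D is
    given only as an almost everywhere limit, with an exceptional set that depends on the boundary
    point and on the sequence. Its bounds therefore hold for each z and almost every y, and Fubini
    for D rests on integrating in y first. These bounds concern y in a compact set, so a compactly
    supported test function is kept throughout: local integrability, weak convergence, the duality
    and the formula for u* come from one statement about such functions, with different choices of
    psi. *)

Section euclidean_norm.
Context {R : realType} {n : nat}.
Implicit Types (x y z : 'rV[R]_n) (A B : set 'rV[R]_n).
Local Notation edist := Defs.edist.

Definition edot x y : R := \sum_(i < n) x ord0 i * y ord0 i.

Lemma edotDr x y z : edot x (y + z) = edot x y + edot x z.
Proof. by rewrite /edot -big_split; apply: eq_bigr => i _; rewrite mxE mulrDr. Qed.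

Lemma edotZr (a : R) x y : edot x (a *: y) = a * edot x y.
Proof. by rewrite /edot mulr_sumr; apply: eq_bigr => i _; rewrite mxE mulrCA. Qed.

Lemma edotC x y : edot x y = edot y x.
Proof. by apply: eq_bigr => i _; rewrite mulrC. Qed.

Lemma edotxx x : edot x x = enorm x ^+ 2.
Proof.
rewrite /enorm sqr_sqrtr; last by apply: sumr_ge0 => i _; exact: sqr_ge0.
by apply: eq_bigr => i _; rewrite expr2.
Qed.

Lemma edotE x y : edot x y = (x *m y^T) ord0 ord0.
Proof. by rewrite mxE; apply: eq_bigr => i _; rewrite mxE. Qed.

Lemma enorm_ge0 x : 0 <= enorm x.
Proof. exact: sqrtr_ge0. Qed.

Lemma enorm0 : enorm (0 : 'rV[R]_n) = 0.
Proof. by rewrite /enorm big1 ?sqrtr0// => i _; rewrite mxE expr0n. Qed.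

Lemma enormZ (a : R) x : enorm (a *: x) = `|a| * enorm x.
Proof.
rewrite /enorm -sqrtr_sqr -sqrtrM ?sqr_ge0// mulr_sumr.
by congr Num.sqrt; apply: eq_bigr => i _; rewrite mxE exprMn.
Qed.

Lemma enormN x : enorm (- x) = enorm x.
Proof. by rewrite -scaleN1r enormZ normrN1 mul1r. Qed.

Lemma enormB x y : enorm (x - y) = enorm (y - x).
Proof. by rewrite -enormN opprB. Qed.

Lemma coord_le_enorm x (i : 'I_n) : `|x ord0 i| <= enorm x.
Proof.
rewrite -sqrtr_sqr ler_sqrt; last by apply: sumr_ge0 => j _; exact: sqr_ge0.
by rewrite (bigD1 i)//= lerDl sumr_ge0// => j _; exact: sqr_ge0.
Qed.

Lemma coord_le_norm x (i : 'I_n) : `|x ord0 i| <= `|x|.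
Proof.
have /mapP[j Hj ->] : `|x ord0 i| \in [seq `|x j.1 j.2| | j : 'I_1 * 'I_n].
  by apply/mapP; exists (ord0, i) => //=; rewrite mem_enum.
by rewrite [leRHS]/Num.norm /= mx_normrE; apply/bigmax_geP; right => /=; exists j.
Qed.

Lemma norm_le_enorm x : `|x| <= enorm x.
Proof.
rewrite [leLHS]/Num.norm /= mx_normrE; apply/bigmax_leP; split; first exact: enorm_ge0.
by move=> -[i j] _ /=; rewrite (ord1 i); exact: coord_le_enorm.
Qed.

Lemma enorm_le_norm x : enorm x <= n%:R * `|x|.
Proof.
rewrite -[leRHS]ger0_norm ?mulr_ge0// -sqrtr_sqr ler_sqrt ?sqr_ge0//.
apply: (@le_trans _ _ (\sum_(i < n) `|x| ^+ 2)).
  apply: ler_sum => i _; rewrite -[_ ^+ 2]ger0_norm ?sqr_ge0// normrX.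
  by rewrite lerXn2r ?nnegrE// coord_le_norm.
rewrite sumr_const card_ord exprMn -[leLHS]mulr_natl; apply: ler_wpM2r; first exact: sqr_ge0.
by case: (n) => [|k]; rewrite ?expr0n// -natrX ler_nat expnS leq_pmulr.
Qed.

Lemma enorm_eq0 x : enorm x = 0 -> x = 0.
Proof.
move=> x0; apply/eqP; rewrite -normr_le0.
by rewrite (le_trans (norm_le_enorm x))// x0.
Qed.

Lemma cauchy_schwarz x y : `|edot x y| <= enorm x * enorm y.
Proof.
have [/enorm_eq0 ->|x0] := eqVneq (enorm x) 0.
  by rewrite /edot big1 ?normr0 ?mulr_ge0 ?enorm_ge0// => i _; rewrite mxE mul0r.
have xp : 0 < enorm x ^+ 2 by rewrite exprn_gt0// lt_neqAle eq_sym x0 enorm_ge0.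
rewrite -[leRHS]ger0_norm ?mulr_ge0 ?enorm_ge0// -ler_sqr ?nnegrE ?normr_ge0//.
rewrite !real_normK ?num_real// exprMn.
(* This vector is [enorm x ^+ 2] times the component of [y] orthogonal to [x]. *)
have : 0 <= enorm (enorm x ^+ 2 *: y - edot x y *: x) ^+ 2 by exact: sqr_ge0.
rewrite -edotxx -scaleNr edotDr !edotZr !(edotC (_ + _)) !edotDr !edotZr edotxx.
rewrite (edotC y x) edotxx.
set a := enorm x ^+ 2; set b := enorm y ^+ 2; set c := edot x y.
rewrite (_ : _ + _ = a * (a * b - c ^+ 2)); last by ring.
by rewrite pmulr_rge0// subr_ge0.
Qed.

Lemma enormD x y : enorm (x + y) <= enorm x + enorm y.
Proof.
rewrite -[leRHS]ger0_norm ?addr_ge0 ?enorm_ge0//.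
rewrite -[leLHS]ger0_norm ?enorm_ge0// -ler_sqr ?nnegrE ?normr_ge0//.
rewrite !real_normK ?num_real// -edotxx edotDr !(edotC (_ + _)) !edotDr.
rewrite !edotxx (edotC y x) sqrrD.
have := le_trans (ler_norm _) (cauchy_schwarz x y).
by lra.
Qed.

Lemma enorm_tri z x y : enorm (x - y) <= enorm (x - z) + enorm (z - y).
Proof. by rewrite -(subrK z x) -addrA (le_trans (enormD _ _))// addrK. Qed.

Lemma enorm_lip x y : `|enorm x - enorm y| <= enorm (x - y).
Proof.
rewrite ler_norml; apply/andP; split.
  rewrite lerNl opprB lerBlDr enormB.
  by have := enormD (y - x) x; rewrite subrK.
by rewrite lerBlDr; have := enormD (x - y) y; rewrite subrK.
Qed.

Lemma lip_continuous (f : 'rV[R]_n -> R) :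
  (forall x y, `|f x - f y| <= enorm (x - y)) -> continuous f.
Proof.
move=> fl x; apply/(@cvgrPdist_le _ _ _ (nbhs x)) => e e0.
near=> y; rewrite (le_trans (fl _ _))// (le_trans (enorm_le_norm _))//.
(* [n.+1] instead of [n] keeps the factor invertible when n = 0. *)
rewrite (@le_trans _ _ (n.+1%:R * `|x - y|)) ?ler_wpM2r ?ler_nat//.
rewrite -ler_pdivlMl ?ltr0n//.
near: y; apply/nbhs_ballP; exists (n.+1%:R^-1 * e) => /=.
  by rewrite mulr_gt0 ?invr_gt0 ?ltr0n.
by move=> y; rewrite -ball_normE => /ltW.
Unshelve. all: by end_near. Qed.

Lemma enorm_continuous : continuous (@enorm R n).
Proof. by apply: lip_continuous; exact: enorm_lip. Qed.

Lemma eball_open x (r : R) : open (eball x r).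
Proof.
rewrite (_ : eball x r = (fun y => enorm (y - x)) @^-1` [set t | t < r]) //.
apply: open_comp; last exact: open_lt.
move=> y _; apply: lip_continuous => a b.
by rewrite (le_trans (enorm_lip _ _))// (_ : _ - _ = a - b)// opprB addrA subrK.
Qed.

Lemma eball_center x (r : R) : 0 < r -> eball x r x.
Proof. by move=> r0; rewrite /eball /= subrr enorm0. Qed.

(** The library topology comes from the max-norm; this equivalence lets later epsilon-delta
    arguments use Euclidean balls. *)
Lemma nbhs_eballP x A :
  nbhs x A <-> exists2 e : R, 0 < e & eball x e `<=` A.
Proof.
split=> [|[e e0 eA]]; last first.
  apply: filterS eA _; apply: open_nbhs_nbhs; split; first exact: eball_open.
  exact: eball_center.
move=> /nbhs_ballP[e /= e0 eA]; exists e => // y xy; apply: eA.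
rewrite -ball_normE /= distrC; apply: le_lt_trans xy; exact: norm_le_enorm.
Qed.

Lemma edist_ge0 A x : 0 <= edist A x.
Proof.
rewrite /edist; have [->|/set0P A0] := eqVneq A set0.
  by rewrite image_set0 inf0.
by apply: lb_le_inf; [exact: image_nonempty|move=> _ [y Ay <-]; exact: enorm_ge0].
Qed.

Lemma edist_le A x y : A y -> edist A x <= enorm (x - y).
Proof.
move=> Ay; apply: ge_inf; last by exists y.
by exists 0 => _ [z _ <-]; exact: enorm_ge0.
Qed.

(** Nonemptiness matters: the infimum of the empty set is 0, which would defeat any positive lower
    bound. *)
Lemma edist_ge A x (c : R) :
  A !=set0 -> (forall y, A y -> c <= enorm (x - y)) -> c <= edist A x.
Proof.
by move=> A0 cA; apply: lb_le_inf; [exact: image_nonempty|move=> _ [y Ay <-]; exact: cA].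
Qed.

Lemma edist_lip A x y : `|edist A x - edist A y| <= enorm (x - y).
Proof.
have [->|/set0P A0] := eqVneq A set0.
  by rewrite /edist !image_set0 inf0 subrr normr0 enorm_ge0.
suff H a b : edist A a - edist A b <= enorm (a - b).
  by rewrite ler_norml H andbT lerNl opprB enormB; exact: H.
rewrite lerBlDl -lerBlDr; apply: edist_ge => // z Az; rewrite lerBlDr.
by rewrite (le_trans (edist_le a Az))// [leRHS]addrC (enorm_tri b).
Qed.

Lemma edist_continuous A : continuous (edist A).
Proof. by apply: lip_continuous; exact: edist_lip. Qed.

Lemma edist_gt0 A x : A !=set0 -> closed A -> ~ A x -> 0 < edist A x.
Proof.
move=> A0 cA nAx; have : nbhs x (~` A).
  by apply: open_nbhs_nbhs; split => //; exact: closed_openC.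
move=> /nbhs_eballP[e e0 eA]; apply: (lt_le_trans e0); apply: edist_ge => // y Ay.
rewrite leNgt; apply/negP => xy; apply: (eA y) => //.
by rewrite /eball/= enormB.
Qed.

Lemma boundary_closed A : closed (boundary A).
Proof.
by rewrite /boundary setDE; apply: closedI; [exact: closed_closure|exact/open_closedC/open_interior].
Qed.

Lemma boundary_open A x : open A -> A x -> ~ boundary A x.
Proof. by move=> /interior_id oA Ax [_]; rewrite oA. Qed.

Lemma bdist_gt0 A x : boundary A !=set0 -> open A -> A x -> 0 < bdist A x.
Proof.
move=> b0 oA Ax; apply: edist_gt0 => //; first exact: boundary_closed.
exact: boundary_open.
Qed.

Lemma bounded_eballP A :
  bounded_set A -> exists2 M : R, 0 < M & forall x, A x -> enorm x <= M.
Proof.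
move=> /pinfty_ex_gt0[M M0 AM].
exists (n%:R * M + 1) => [|x Ax]; first by rewrite ltr_pwDr// mulr_ge0// ltW.
rewrite (le_trans (enorm_le_norm _))// (@le_trans _ _ (n%:R * M)) ?lerDl//.
by rewrite ler_wpM2l//; exact: AM.
Qed.

Lemma eball_bounded A (M : R) : (forall x, A x -> enorm x <= M) -> bounded_set A.
Proof.
move=> AM; exists M; split; first exact: num_real.
move=> t Mt x Ax /=; rewrite (le_trans (norm_le_enorm _))//.
by rewrite (le_trans (AM _ Ax))// ltW.
Qed.

Lemma closure_bounded A : bounded_set A -> bounded_set (closure A).
Proof.
move=> /bounded_eballP[M M0 AM]; apply: (@eball_bounded _ M).
suff : closure A `<=` enorm @^-1` [set t | t <= M] by [].
rewrite closureE; apply: smallest_sub => //.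
apply: closed_comp; last exact: closed_le.
by move=> x _; exact: enorm_continuous.
Qed.

Lemma boundary_compact A : bounded_set A -> compact (boundary A).
Proof.
move=> bA; apply: bounded_closed_compact; last exact: boundary_closed.
have /bounded_eballP[M _ AM] := closure_bounded bA.
by apply: (@eball_bounded _ M) => x [/AM].
Qed.

End euclidean_norm.

Section euclidean_coordinates.
Context {R : realType} {n : nat}.

Lemma enorm_mulmx (Q : 'M[R]_n) (x : 'rV[R]_n) :
  Q *m Q^T = 1%:M -> enorm (x *m Q) = enorm x.
Proof.
move=> QQ; apply/eqP; rewrite -(@eqrXn2 _ 2) ?enorm_ge0//; apply/eqP.
by rewrite -!edotxx !edotE trmx_mul mulmxA -(mulmxA x) QQ mulmx1.
Qed.

Lemma cons_rV0 (t : R) (y : 'rV[R]_n) : cons_rV t y ord0 ord0 = t.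
Proof. by have := cons_rVK (t, y); rewrite /uncons_rV /= => -[]. Qed.

Lemma cons_rVS (t : R) (y : 'rV[R]_n) i : cons_rV t y ord0 (lift ord0 i) = y ord0 i.
Proof.
have := cons_rVK (t, y); rewrite /uncons_rV /= => -[_ {2}<-].
by rewrite [RHS]mxE; congr (fun_of_matrix _ _ _); exact: val_inj.
Qed.

Lemma uncons_rVK (v : 'rV[R]_n.+1) :
  cons_rV (uncons_rV v).1 (uncons_rV v).2 = v.
Proof.
apply/rowP => i; case: (unliftP ord0 i) => [j ->|->]; last by rewrite cons_rV0.
by rewrite cons_rVS mxE; congr (v _ _); exact: val_inj.
Qed.

Lemma cons_rVD (t t' : R) (y y' : 'rV[R]_n) :
  cons_rV t y + cons_rV t' y' = cons_rV (t + t') (y + y').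
Proof.
apply/rowP => i; rewrite mxE; case: (unliftP ord0 i) => [j ->|->].
  by rewrite !cons_rVS mxE.
by rewrite !cons_rV0.
Qed.

Lemma cons_rVN (t : R) (y : 'rV[R]_n) : - cons_rV t y = cons_rV (- t) (- y).
Proof.
apply/rowP => i; rewrite mxE; case: (unliftP ord0 i) => [j ->|->].
  by rewrite !cons_rVS mxE.
by rewrite !cons_rV0.
Qed.

Lemma enorm_cons (t : R) (y : 'rV[R]_n) :
  enorm (cons_rV t y) ^+ 2 = t ^+ 2 + enorm y ^+ 2.
Proof.
rewrite -!edotxx /edot big_ord_recl cons_rV0 expr2; congr (_ + _).
by apply: eq_bigr => i _; rewrite cons_rVS.
Qed.

End euclidean_coordinates.

(** * Lebesgue measure on row vectors *)

Section rV_borel.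
Context {R : realType} {n : nat}.

(** A ball of the max-norm is a box, hence a finite intersection of coordinate preimages of
    intervals. *)
Lemma ball_measurable_rV (x : 'rV[R]_n) (e : R) : measurable (ball x e).
Proof.
have [e0|e0] := leP e 0.
  rewrite (_ : ball x e = set0) // -subset0 => y.
  by rewrite -ball_normE /= ltNge (le_trans e0).
rewrite (_ : ball x e = \big[setI/setT]_(i < n)
    ((fun v : 'rV[R]_n => v ord0 i) @^-1` ball (x ord0 i) e)).
  apply: bigsetI_measurable => i _; rewrite -[X in measurable X]setTI.
  apply: measurable_coord => //; apply: open_measurable; exact: ball_open.
rewrite -bigcap_seq; apply/seteqP; split=> [y [_ xy] i _|y xy] /=.
  exact: xy.
split=> // i j; rewrite (ord1 i); apply: (xy j) => /=; exact: mem_index_enum.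
Qed.

(** The sigma-algebra is generated by the coordinates, so an open set is written as a countable
    union of boxes: the balls with rational centre and radius 1 / (k + 1) that it contains,
    enumerated through [pickle]. *)
Lemma open_measurable_rV (U : set 'rV[R]_n) : open U -> measurable U.
Proof.
move=> oU.
pose q (p : 'rV[rat]_n * nat) : set 'rV[R]_n :=
  ball (map_mx ratr p.1 : 'rV[R]_n) (p.2.+1%:R^-1).
pose F (p : 'rV[rat]_n * nat) := if `[< q p `<=` U >] then q p else set0.
rewrite (_ : U = \bigcup_k oapp F set0 (unpickle k)).
  apply: bigcupT_measurable => k; case: unpickle => [p|] //=.
  by rewrite /F; case: ifPn => // _; exact: ball_measurable_rV.
apply/seteqP; split=> [x Ux|x [k _]]; last first.
  by case: unpickle => [p|] //=; rewrite /F; case: asboolP => // qU /qU.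
have /nbhs_ballP[e /= e0 eU] : nbhs x U by exact: open_nbhs_nbhs.
have [k ke] : exists k : nat, k.+1%:R^-1 < e / 2.
  have := @near_infty_natSinv_lt R (PosNum (divr_gt0 e0 (ltr0Sn R 1))).
  by case=> k _ /(_ k (leqnn k)); exists k.
have kp : 0 < k.+1%:R^-1 :> R by rewrite invr_gt0 ltr0n.
have xq (i : 'I_n) : exists r : rat, `|x ord0 i - ratr r| < k.+1%:R^-1.
  have [|r rx] := @rat_in_itvoo R (x ord0 i - k.+1%:R^-1) (x ord0 i + k.+1%:R^-1).
    by rewrite ltrD2l gtrN.
  by exists r; move: rx; rewrite in_itv /= ltr_distlC.
have [r rP] := choice xq.
pose p : 'rV[rat]_n * nat := (\row_i r i, k).
have qx : q p x.
  by split=> //= i j; rewrite (ord1 i) !mxE /ball /= distrC; exact: rP.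
exists (pickle p) => //; rewrite pickleK /= /F; case: asboolP => // nqU.
exfalso; apply: nqU => y qy; apply: eU.
apply: (@le_ball _ _ _ (k.+1%:R^-1 + k.+1%:R^-1)).
  by rewrite (splitr e) ltW// ltrD.
by apply: ball_triangle qy; exact: ball_sym.
Qed.

Lemma closed_measurable_rV (A : set 'rV[R]_n) : closed A -> measurable A.
Proof.
by move/closed_openC/open_measurable_rV/measurableC; rewrite setCK.
Qed.

Lemma compact_measurable_rV (A : set 'rV[R]_n) : compact A -> measurable A.
Proof.
by move=> cA; apply: closed_measurable_rV; apply: compact_closed => //; exact: norm_hausdorff.
Qed.

Lemma continuous_measurable_rV (f : 'rV[R]_n -> R) :
  continuous f -> measurable_fun setT f.
Proof.
move=> cf; apply: (measurability _ (RGenOpens.measurableE R)).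
move=> _ [_ [a [b ->]] <-]; rewrite setTI; apply: open_measurable_rV.
by apply: open_comp => [x _|]; [exact: cf|exact: interval_open].
Qed.

Lemma eball_measurable (x : 'rV[R]_n) (r : R) : measurable (eball x r).
Proof. by apply: open_measurable_rV; exact: eball_open. Qed.

Context d (X : measurableType d).

Lemma measurable_fun_coord (f : X -> 'rV[R]_n) i :
  measurable_fun setT f -> measurable_fun setT (fun x => f x ord0 i).
Proof. exact: (measurableT_comp (measurable_coord i)). Qed.

Lemma measurable_rVD (f g : X -> 'rV[R]_n) :
  measurable_fun setT f -> measurable_fun setT g ->
  measurable_fun setT (fun x => f x + g x).
Proof.
move=> mf mg; apply: measurable_fun_rVP => i.
rewrite (_ : (fun _ => _) = (fun x => f x ord0 i + g x ord0 i)).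
  by apply: measurable_funD; exact: measurable_fun_coord.
by apply/funext => x; rewrite mxE.
Qed.

Lemma measurable_rVN (f : X -> 'rV[R]_n) :
  measurable_fun setT f -> measurable_fun setT (fun x => - f x).
Proof.
move=> mf; apply: measurable_fun_rVP => i.
rewrite (_ : (fun _ => _) = (fun x => - (f x ord0 i))).
  by apply: measurableT_comp => //; exact: measurable_fun_coord.
by apply/funext => x; rewrite mxE.
Qed.

Lemma measurable_mulmxr k (Q : 'M[R]_(n, k)) (f : X -> 'rV[R]_n) :
  measurable_fun setT f -> measurable_fun setT (fun x => f x *m Q).
Proof.
move=> mf; apply: measurable_fun_rVP => i.
rewrite (_ : (fun _ => _) = (fun x => \sum_(j < n) f x ord0 j * Q j i)).
  apply: measurable_sum => j.
  by apply: measurable_funM => //; exact: measurable_fun_coord.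
by apply/funext => x; rewrite mxE.
Qed.

Lemma measurable_fun_cons (t : X -> R) (f : X -> 'rV[R]_n) :
  measurable_fun setT t -> measurable_fun setT f ->
  measurable_fun setT (fun x => cons_rV (t x) (f x)).
Proof.
move=> mt mf; apply: measurable_fun_rVP => i.
case: (unliftP ord0 i) => [j ->|->].
  under eq_fun do rewrite cons_rVS; exact: measurable_fun_coord.
by under eq_fun do rewrite cons_rV0.
Qed.

Lemma measurable_preimage d' (Y : measurableType d') (f : X -> Y) (A : set Y) :
  measurable_fun setT f -> measurable A -> measurable [set x | A (f x)].
Proof. by move=> mf mA; rewrite -[X in measurable X]setTI; exact: mf. Qed.

End rV_borel.

Section image_measure.
Context d1 d2 (T1 : measurableType d1) (T2 : measurableType d2) (R : realType).
Variables (m : {measure set T1 -> \bar R}) (f : T1 -> T2).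

Definition image_measure (mf : measurable_fun setT f) : {measure set T2 -> \bar R} :=
  measure_function_pushforward__canonical__measure_function_Measure m mf.

Lemma image_measureE (mf : measurable_fun setT f) A :
  image_measure mf A = m (f @^-1` A).
Proof. by []. Qed.

End image_measure.

Section lebesgue_invariance.
Context {R : realType}.

Lemma lebesgue_rVS n (A : set 'rV[R]_n.+1) : measurable A ->
  lebesgue_rV n.+1 A =
  pushforward (@lebesgue_measure R \x lebesgue_rV n)%E (fun p => cons_rV p.1 p.2) A.
Proof.
move=> mA; rewrite /pushforward /= /product_measure1.
apply: eq_integral => t _ /=; congr (lebesgue_rV n _).
by apply/funext => y; rewrite /xsection /= -[LHS]asboolE.
Qed.

(** By uniqueness of Lebesgue measure: k times its image under t -> a + k * t gives every interval
    ]b, c] its length. *)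
Lemma lebesgue_measure_affine (a k : R) (A : set R) : 0 < k -> measurable A ->
  (lebesgue_measure A = k%:E * lebesgue_measure [set t | A (a + k * t)%R])%E.
Proof.
move=> k0 mA.
pose h : measurableTypeR R -> measurableTypeR R := fun t => a + k * t.
have mh : measurable_fun setT h.
  by apply: measurable_funD => //; apply: measurable_funM.
pose kn : {nonneg R} := NngNum (ltW k0).
pose nu := mscale kn (image_measure (@lebesgue_measure R) mh).
have nuE B : nu B = (k%:E * lebesgue_measure (h @^-1` B))%E by [].
rewrite -[RHS]nuE.
apply: (@lebesgue_measure_unique R [the {measure set (measurableTypeR R) -> \bar R} of nu]) => //.
move=> _ [[b c]] _ <-.
rewrite -[RHS]/(k%:E * lebesgue_measure (h @^-1` [set` `]b, c]]))%E.
have -> : h @^-1` [set` `]b, c]] = [set` `](b - a) / k, (c - a) / k]].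
  apply/seteqP; split=> t; rewrite /= !in_itv /= ltr_pdivrMr// ler_pdivlMr//;
  by rewrite ltrBlDl lerBrDl mulrC.
rewrite !lebesgue_measure_itv /= !lte_fin ltr_pM2r ?invr_gt0// ltrD2r.
case: ifPn => _; last by rewrite mule0.
by rewrite -EFinM; congr (_%:E); field; rewrite gt_eqF.
Qed.

Lemma measurable_xsection_cons n (A : set 'rV[R]_n.+1) (t : R) :
  measurable A -> measurable [set y | A (cons_rV t y)].
Proof.
move=> mA.
apply: (measurable_preimage (f := cons_rV t)) => //.
exact: measurable_fun_cons.
Qed.

Lemma lebesgue_rV_translation n (a : 'rV[R]_n) (A : set 'rV[R]_n) :
  measurable A -> lebesgue_rV n [set x | A (x + a)] = lebesgue_rV n A.
Proof.
elim: n a A => [|n IH] a A mA.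
  congr (lebesgue_rV 0 _); apply/funext => x /=; congr A.
  by apply/rowP => -[].
rewrite /=.
transitivity (\int[@lebesgue_measure R]_t
    (lebesgue_rV n [set y | A (cons_rV (t + (uncons_rV a).1) y)]))%E.
  apply: eq_integral => t _.
  have mAt := @measurable_xsection_cons n A (t + (uncons_rV a).1) mA.
  rewrite -(IH (uncons_rV a).2 _ mAt).
  congr (lebesgue_rV n _); apply/funext => y /=.
  by rewrite -cons_rVD uncons_rVK.
(* The induction hypothesis has dealt with the fibres. What remains is a translation of the outer
   variable, that is, an integral against an image measure which is Lebesgue measure again. *)
have mh : measurable_fun setT (fun t : measurableTypeR R => (t + (uncons_rV a).1) : measurableTypeR R).
  by apply: measurable_funD.
pose F (t : R) := lebesgue_rV n [set y | A (cons_rV t y)].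
have mF : measurable_fun setT (F : measurableTypeR R -> \bar R).
  pose B := [set p : measurableTypeR R * 'rV[R]_n | A (cons_rV p.1 p.2)].
  have mB : measurable B.
    by rewrite -[X in measurable X]setTI; exact: measurable_cons_rV.
  have := measurable_fun_xsection (lebesgue_rV n) mB.
  congr (measurable_fun _ _); apply/funext => t; congr (lebesgue_rV n _).
  by apply/funext => y; rewrite /xsection /= /B /= -[RHS]asboolE.
transitivity (\int[image_measure (@lebesgue_measure R) mh]_t F t)%E.
  by rewrite ge0_integral_pushforward.
apply: eq_measure_integral => B mB _.
rewrite image_measureE [RHS](@lebesgue_measure_affine (uncons_rV a).1 1)// mul1e.
by congr (lebesgue_measure _); apply/funext => t /=; rewrite mul1r addrC.
Qed.

End lebesgue_invariance.

Section product_sections.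
Context d1 d2 (T1 : measurableType d1) (T2 : measurableType d2) (R : realType).
Variables (mu : {sigma_finite_measure set T1 -> \bar R}).
Variables (nu : {sigma_finite_measure set T2 -> \bar R}).
Variables (S : set (T1 * T2)) (mS : measurable S).

Let xsectionS : nu \o xsection S = fun x => nu [set y | S (x, y)].
Proof.
apply/funext => x /=; congr (nu _); apply/funext => y.
by rewrite /xsection /= -[RHS]asboolE.
Qed.

Let ysectionS : mu \o ysection S = fun y => mu [set x | S (x, y)].
Proof.
apply/funext => y /=; congr (mu _); apply/funext => x.
by rewrite /ysection /= -[RHS]asboolE.
Qed.

Lemma measurable_yslice : measurable_fun setT (fun y => mu [set x | S (x, y)]).
Proof. by rewrite -ysectionS; exact: measurable_fun_ysection. Qed.

Lemma product_measure_xslice :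
  ((mu \x nu) S = \int[mu]_x nu [set y | S (x, y)])%E.
Proof. by rewrite -xsectionS. Qed.

Lemma integral_sections :
  (\int[mu]_x nu [set y | S (x, y)] = \int[nu]_y mu [set x | S (x, y)])%E.
Proof.
have := indic_fubini_tonelli mu nu mS.
rewrite (@indic_fubini_tonelli_FE _ _ _ _ _ nu _ mS).
by rewrite (@indic_fubini_tonelli_GE _ _ _ _ _ mu _ mS) xsectionS ysectionS.
Qed.

Lemma product_measure_yslice :
  ((mu \x nu) S = \int[nu]_y mu [set x | S (x, y)])%E.
Proof. by rewrite product_measure_xslice integral_sections. Qed.

End product_sections.

(** * Comparison of translation-invariant measures *)

Section haar.
Context {R : realType} {n : nat}.
Local Notation T := 'rV[R]_n.

Definition translation_invariant (mu : set T -> \bar R) :=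
  forall (a : T) (A : set T), measurable A -> mu [set x | A (x + a)] = mu A.

Lemma integral_cst_indic (mu : {measure set T -> \bar R}) (A : set T) (c : \bar R) :
  measurable A -> (0 <= c)%E -> (\int[mu]_x (c * (\1_A x)%:E) = c * mu A)%E.
Proof.
move=> mA c0; rewrite ge0_integralZl//; first by rewrite integral_indic// setIT.
exact/measurable_EFinP.
Qed.

(* Both sides compute (mu x nu) {(x, y) | A (x + y) /\ B y}: integrating over x
   first gives the left-hand side; substituting y - x for y, the right-hand side. *)
Lemma translation_invariant_exchange
    (mu nu : {sigma_finite_measure set T -> \bar R}) (A B : set T) :
  translation_invariant mu -> translation_invariant nu ->
  measurable A -> measurable B ->
  (mu A * nu B = mu [set x | B (- x)%R] * nu A)%E.
Proof.
move=> tmu tnu mA mB.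
have mfst : measurable_fun setT (fun p : T * T => p.1) by exact: measurable_fst.
have msnd : measurable_fun setT (fun p : T * T => p.2) by exact: measurable_snd.
pose S := [set p : T * T | A (p.1 + p.2) /\ B p.2].
have mS : measurable S.
  apply: (@measurableI _ _ [set p : T * T | A (p.1 + p.2)] [set p : T * T | B p.2]).
    by apply: measurable_preimage mA; exact: measurable_rVD.
  exact: measurable_preimage mB.
pose S' := [set p : T * T | A p.2 /\ B (p.2 - p.1)].
have mS' : measurable S'.
  apply: (@measurableI _ _ [set p : T * T | A p.2] [set p : T * T | B (p.2 - p.1)]).
    exact: measurable_preimage mA.
  by apply: measurable_preimage mB; apply: measurable_rVD => //; exact: measurable_rVN.
rewrite -!integral_cst_indic//.
transitivity (\int[nu]_y mu [set x | S (x, y)])%E.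
  apply: eq_integral => y _; rewrite indicE; have [yB|yB] := boolP (y \in B).
    rewrite mule1 -(tmu y A mA); congr (mu _).
    by apply/seteqP; split=> x; rewrite /S /=; move/set_mem: yB; tauto.
  rewrite mule0 (_ : [set x | S (x, y)] = set0) ?measure0//.
  by rewrite -subset0 => x [_]; move/negP: yB; rewrite inE.
rewrite -integral_sections//.
transitivity (\int[mu]_x nu [set y | S' (x, y)])%E.
  apply: eq_integral => x _.
  have mS'x : measurable [set y | S' (x, y)].
    by apply: (measurable_preimage (f := fun y : T => (x, y))) => //; exact: measurable_fun_pair.
  rewrite -(tnu x _ mS'x); congr (nu _); apply/seteqP; split=> y; rewrite /S /S' /=.
    by rewrite addrC addrK.
  by rewrite [x + y]addrC addrK.
rewrite integral_sections//; apply: eq_integral => y _; rewrite indicE.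
have mB' : measurable [set x : T | B (- x)].
  by apply: measurable_preimage mB; exact: measurable_rVN.
have [yA|yA] := boolP (y \in A).
  rewrite mule1 -(tmu (- y) _ mB'); congr (mu _); apply/seteqP; split=> x; rewrite /S' /=.
    by rewrite opprD opprK addrC => -[].
  by rewrite opprD opprK addrC; split => //; exact: set_mem.
rewrite mule0 (_ : [set x | S' (x, y)] = set0) ?measure0//.
by rewrite -subset0 => x [] + _; move/negP: yA; rewrite inE.
Unshelve. all: try exact: measure_ge0.
Qed.

End haar.

Section sigma_finite_measure_of.
Context d (T : measurableType d) (R : realType) (m : {measure set T -> \bar R}).
Hypothesis fm : sigma_finite setT m.

(** A synonym of [m] to which the sigma-finite structure can be attached under the hypothesis [fm];
    Fubini is stated for such structures. *)
Definition sigma_finite_of : set T -> \bar R := m.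

HB.instance Definition _ := Measure.on sigma_finite_of.
HB.instance Definition _ :=
  Measure_isSigmaFinite.Build _ _ _ sigma_finite_of fm.

Lemma sigma_finite_measureP :
  exists mu : {sigma_finite_measure set T -> \bar R}, mu = m :> (set T -> \bar R).
Proof. by exists [the {sigma_finite_measure set T -> \bar R} of sigma_finite_of]. Qed.

End sigma_finite_measure_of.

(** * Rotation invariance of Lebesgue measure *)

Section lebesgue_rotation.
Context {R : realType}.

Definition cube n (M : R) : set 'rV[R]_n := [set x | forall i, `|x ord0 i| <= M].

Lemma cube_measurable n (M : R) : measurable (@cube n M).
Proof.
rewrite (_ : @cube n M = \big[setI/setT]_(i < n) [set x : 'rV[R]_n | `|x ord0 i| <= M]).
  apply: bigsetI_measurable => i _.
  apply: (measurable_preimage (f := fun x : 'rV[R]_n => `|x ord0 i|) (A := `]-oo, M]%classic)) => //.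
    by apply: measurableT_comp => //; exact: measurable_coord.
rewrite -bigcap_seq; apply/seteqP; split=> [x xM i _|x xM i] /=; first exact: xM.
by apply: (xM i) => /=; exact: mem_index_enum.
Qed.

Lemma lebesgue_rV_cube n (M : R) : 0 <= M ->
  lebesgue_rV n (@cube n M) = ((2 * M) ^+ n)%:E.
Proof.
move=> M0; elim: n => [|n IH]; first by rewrite /= diracE mem_set// => -[].
rewrite /=.
transitivity (\int[@lebesgue_measure R]_t (lebesgue_rV n (@cube n M) *
    (\1_(`[- M, M]%classic : set R) t)%:E))%E.
  apply: eq_integral => t _; rewrite indicE.
  have [tM|tM] := boolP (t \in _).
    rewrite mule1; congr (lebesgue_rV n _); apply/seteqP; split=> y yM.
      by move=> i; have := yM (lift ord0 i); rewrite cons_rVS.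
    move=> i; case: (unliftP ord0 i) => [j ->|->]; first by rewrite cons_rVS.
    by rewrite cons_rV0; move/set_mem: tM => /=; rewrite in_itv /= ler_norml.
  rewrite mule0 (_ : [set y | _] = set0) ?measure0// -subset0 => y /(_ ord0).
  by rewrite cons_rV0 => tM'; move/negP: tM; apply; rewrite inE /= in_itv /= -ler_norml.
rewrite ge0_integralZl//; last exact/measurable_EFinP.
have lM : lebesgue_measure (`[- M, M]%classic : set R) = (2 * M)%:E.
  rewrite lebesgue_measure_itv /= lte_fin.
  case: ltP => MM; first by rewrite -EFinD; congr EFin; ring.
  by congr EFin; lra.
rewrite integral_indic// setIT IH.
transitivity (((2 * M) ^+ n)%:E * lebesgue_measure (`[(- M)%R, M]%classic : set R))%E => //.
by rewrite lM -EFinM exprSr.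
Qed.

Lemma enorm_sub_cube n (r : R) : [set x | enorm x <= r] `<=` @cube n r.
Proof. by move=> x xr i; rewrite (le_trans (coord_le_enorm x i)). Qed.

Lemma lebesgue_rV_bounded n (A : set 'rV[R]_n) (r : R) :
  measurable A -> (forall x, A x -> enorm x <= r) -> (lebesgue_rV n A < +oo)%E.
Proof.
move=> mA Ar; have r0 : 0 <= Num.max r 0 by rewrite le_max lexx orbT.
apply: (@le_lt_trans _ _ (lebesgue_rV n (@cube n (Num.max r 0)))).
  apply: le_measure; rewrite ?inE//; first exact: cube_measurable.
  by move=> x /Ar xr; apply: enorm_sub_cube; rewrite /= le_max xr.
by rewrite lebesgue_rV_cube// ltry.
Qed.

Lemma lebesgue_rV_eball_gt0 n (x : 'rV[R]_n) (r : R) : 0 < r ->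
  (0 < lebesgue_rV n (eball x r))%E.
Proof.
move=> r0; rewrite -(lebesgue_rV_translation x (eball_measurable x r)).
(* The Euclidean norm is at most n * M <= r / 2 on the cube of half-side M; [n.+1] covers n = 0. *)
pose M := r / (n.+1%:R * 2).
have M0 : 0 < M by rewrite divr_gt0// mulr_gt0// ltr0n.
apply: (@lt_le_trans _ _ (lebesgue_rV n (@cube n M))).
  by rewrite lebesgue_rV_cube ?(ltW M0)// lte_fin exprn_gt0// mulr_gt0.
apply: le_measure; rewrite ?inE; [exact: cube_measurable| |].
  by apply: measurable_preimage (eball_measurable x r); exact: measurable_rVD.
move=> y yM; rewrite /eball /= addrK (le_lt_trans (enorm_le_norm _))//.
have yM' : `|y| <= M.
  rewrite [leLHS]/Num.norm /= mx_normrE; apply/bigmax_leP; split; first exact: ltW.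
  by move=> -[i j] _ /=; rewrite (ord1 i); exact: yM.
apply: (@le_lt_trans _ _ (n.+1%:R * M)).
  by rewrite ler_pM// ler_nat.
have -> : n.+1%:R * M = r / 2.
  have k0 : n.+1%:R != 0 :> R by rewrite pnatr_eq0.
  by rewrite /M; move: (n.+1%:R) k0 => k k0; field.
lra.
Qed.

Lemma lebesgue_rV_open_gt0 n (U : set 'rV[R]_n) : open U -> U !=set0 ->
  (0 < lebesgue_rV n U)%E.
Proof.
move=> oU [x Ux]; have : nbhs x U by exact: open_nbhs_nbhs.
move=> /nbhs_eballP[e e0 eU].
apply: (lt_le_trans (lebesgue_rV_eball_gt0 x e0)).
by apply: le_measure; rewrite ?inE//; [exact: eball_measurable|exact: open_measurable_rV].
Qed.

(** The image of Lebesgue measure under the rotation is translation invariant, so the exchange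
    identity applies, with the unit ball as second set. The ball is preserved by the rotation and by
    x -> - x, and its measure, being positive and finite, cancels. *)
Lemma lebesgue_rV_rotation n (Q : 'M[R]_n) (A : set 'rV[R]_n) :
  Q *m Q^T = 1%:M -> measurable A ->
  lebesgue_rV n [set x | A (x *m Q)] = lebesgue_rV n A.
Proof.
move=> QQ mA.
have mQ : measurable_fun setT (fun x : 'rV[R]_n => x *m Q) by exact: measurable_mulmxr.
have ballQ (r : R) : (fun x : 'rV[R]_n => x *m Q) @^-1` (eball 0 r) = eball 0 r.
  by apply/seteqP; split => x; rewrite /eball /= !subr0 enorm_mulmx.
have ball_lty (r : R) : (lebesgue_rV n (eball 0 r) < +oo)%E.
  apply: (@lebesgue_rV_bounded _ _ r); first exact: eball_measurable.
  by move=> x; rewrite /eball /= subr0 => /ltW.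
have [mu muE] : exists mu : {sigma_finite_measure set 'rV[R]_n -> \bar R},
    mu = image_measure (lebesgue_rV n) mQ :> (set 'rV[R]_n -> \bar R).
  apply: sigma_finite_measureP; exists (fun k => eball 0 k%:R).
    apply/seteqP; split=> // x _; exists (Num.truncn (enorm x)).+1 => //.
    by rewrite /eball /= subr0 truncnS_gt.
  move=> k; split; first exact: eball_measurable.
  by rewrite image_measureE ballQ; exact: ball_lty.
have tmu : translation_invariant mu.
  move=> a B mB; rewrite muE !image_measureE /=.
  rewrite -(lebesgue_rV_translation (- (a *m Q^T))); last first.
    apply: (measurable_preimage (f := fun x : 'rV[R]_n => x *m Q + a)) => //.
    exact: measurable_rVD.
  congr (lebesgue_rV n _); apply/funext => x /=; congr B.
  by rewrite mulmxDl mulNmx -mulmxA (mulmx1C QQ) mulmx1 subrK.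
have tl : translation_invariant (@lebesgue_rV R n) by move=> *; exact: lebesgue_rV_translation.
have := translation_invariant_exchange tmu tl mA (eball_measurable 0 1).
have -> : [set x : 'rV[R]_n | eball 0 1 (- x)] = eball 0 1.
  by apply/funext => x; rewrite /eball /= !subr0 enormN.
rewrite muE !image_measureE ballQ [RHS]muleC.
have := ball_lty 1; have := lebesgue_rV_eball_gt0 (0 : 'rV[R]_n) ltr01.
rewrite /=; case: (lebesgue_rV n (eball 0 1)) => [b| |]//; rewrite lte_fin => b0 _.
by move=> e; apply/le_anti/andP; split; rewrite -(@lee_pmul2r _ b%:E)// e.
Qed.

End lebesgue_rotation.

Lemma integral_mscale d (T : measurableType d) (R : realType)
    (m : {measure set T -> \bar R}) (D : set T) (k : {nonneg R}) (f : T -> \bar R) :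
  measurable D -> m.-integrable D f ->
  (\int[mscale k m]_(x in D) f x = k%:num%:E * \int[m]_(x in D) f x)%E.
Proof.
move=> mD intf; have mf : measurable_fun D f by case/integrableP: intf.
rewrite [LHS]integralE [X in (_ * X)%E]integralE !ge0_integral_mscale//; last 2 first.
  exact: measurable_funeneg.
  exact: measurable_funepos.
rewrite [RHS]muleBr//; apply: fin_num_adde_defl.
by rewrite fin_numN; apply: integrable_neg_fin_num.
Qed.

(** * Graph charts *)

Section chart.
Context {R : realType} {m : nat}.
Implicit Types (c : 'rV[R]_m.+1) (Q : 'M[R]_m.+1) (phi : 'rV[R]_m -> R) (y : 'rV[R]_m).

(* The boundary point above y, moved by k * tau in the direction of the graph. *)
Definition chart_map c Q phi (k : R) (p : measurableTypeR R * 'rV[R]_m) : 'rV[R]_m.+1 :=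
  c + cons_rV (phi p.2 + k * p.1) p.2 *m Q^T.

Lemma measurable_chart_map c Q phi k :
  measurable_fun setT phi -> measurable_fun setT (chart_map c Q phi k).
Proof.
move=> mphi; apply: measurable_rVD => //; apply: measurable_mulmxr.
apply: measurable_fun_cons; last exact: measurable_snd.
apply: measurable_funD.
  exact: (measurableT_comp mphi measurable_snd).
apply: measurable_funM => //.
Qed.

(** The chart map is a translation and a rotation after (tau, y) -> (phi y + k * tau, y). On each
    fibre over y the latter is affine of slope k, so slicing over y makes the change of variables
    one-dimensional. *)
Lemma lebesgue_chart c Q phi k (B : set 'rV[R]_m.+1) :
  0 < k -> Q *m Q^T = 1%:M -> measurable_fun setT phi -> measurable B ->
  (lebesgue_rV m.+1 B =
   k%:E * (@lebesgue_measure R \x lebesgue_rV m) (chart_map c Q phi k @^-1` B))%E.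
Proof.
move=> k0 QQ mphi mB.
rewrite -(lebesgue_rV_translation c mB).
have mBc : measurable [set x | B (x + c)].
  by apply: measurable_preimage mB; exact: measurable_rVD.
have QTQ : Q^T *m Q^T^T = 1%:M by rewrite trmxK (mulmx1C QQ).
rewrite -(lebesgue_rV_rotation QTQ mBc).
rewrite lebesgue_rVS; last first.
  by apply: (measurable_preimage (f := fun x : 'rV[R]_m.+1 => x *m Q^T)) => //; exact: measurable_mulmxr.
rewrite /pushforward.
set E := (X in product_measure1 _ _ X).
have mE : measurable E.
  apply: (measurable_preimage (f := fun p : measurableTypeR R * 'rV[R]_m => cons_rV p.1 p.2 *m Q^T)) mBc.
  by apply: measurable_mulmxr; apply: measurable_fun_cons; [exact: measurable_fst|exact: measurable_snd].
have mC : measurable (chart_map c Q phi k @^-1` B).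
  by apply: measurable_preimage mB; exact: measurable_chart_map.
rewrite [LHS](product_measure_yslice _ _ mE) product_measure_yslice//.
rewrite -ge0_integralZl//; last 2 first.
- exact: (measurable_yslice _ mC).
- by rewrite lee_fin ltW.
apply: eq_integral => y _.
have mEy : measurable [set t : measurableTypeR R | E (t, y)].
  by apply: (measurable_preimage (f := fun t : measurableTypeR R => (t, y))) => //; exact: measurable_fun_pair.
rewrite [LHS](@lebesgue_measure_affine _ (phi y) k)//.
congr (_ * lebesgue_measure _)%E; apply/funext => t.
by rewrite /E /chart_map /= addrC.
Qed.

Lemma integral_chart c Q phi k (g : 'rV[R]_m.+1 -> \bar R) :
  0 < k -> Q *m Q^T = 1%:M -> measurable_fun setT phi -> measurable_fun setT g ->
  (@lebesgue_measure R \x lebesgue_rV m)%E.-integrable setT (g \o chart_map c Q phi k) ->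
  (\int[lebesgue_rV m.+1]_x g x =
   k%:E * \int[@lebesgue_measure R \x lebesgue_rV m]_p g (chart_map c Q phi k p))%E.
Proof.
move=> k0 QQ mphi mg ig.
have mc := measurable_chart_map c Q k mphi.
pose kn : {nonneg R} := NngNum (ltW k0).
pose nu := image_measure [the {measure set _ -> \bar R} of (@lebesgue_measure R \x lebesgue_rV m)%E] mc.
transitivity (\int[mscale kn nu]_x g x)%E.
  apply: eq_measure_integral => A mA _.
  by rewrite [LHS](@lebesgue_chart c Q phi k).
rewrite integral_mscale//; last exact: integrable_pushforward.
by congr (_ * _)%E; rewrite [LHS]integral_pushforward.
Qed.

End chart.

Section lipschitz_functions.
Context {R : realType} {n : nat}.
Implicit Types (f : 'rV[R]_n -> R).

Lemma lipschitz_enorm_continuous f (K : R) :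
  (forall x y, `|f x - f y| <= K * enorm (x - y)) -> continuous f.
Proof.
move=> fK.
have K1 : 0 < `|K| + 1 by rewrite ltr_pwDr.
have cg : continuous (fun x => (`|K| + 1)^-1 * f x).
  apply: lip_continuous => x y; rewrite -mulrBr normrM gtr0_norm ?invr_gt0//.
  rewrite ler_pdivrMl// (le_trans (fK x y))// ler_wpM2r ?enorm_ge0//.
  by rewrite (le_trans (ler_norm K))// lerDl.
rewrite (_ : f = fun x => (`|K| + 1) * ((`|K| + 1)^-1 * f x)).
  by move=> x; apply: (@cvgM _ _ (nbhs x)); [exact: cvg_cst|exact: cg].
by apply/funext => x; rewrite mulrA divff ?mul1r// gt_eqF.
Qed.

End lipschitz_functions.

(** * Functions of class C^{1,1} *)

Section c11.
Context {R : realType} {m : nat}.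
Variables (phi : 'rV[R]_m -> R) (phiC11 : C11 phi).

Lemma C11_continuous : continuous phi.
Proof. by move=> y; apply: differentiable_continuous; case: phiC11. Qed.

Lemma diff_grad (y h : 'rV[R]_m) : 'd phi y h = edot (grad phi y) h.
Proof.
have [dphi _] := phiC11.
rewrite {1}(row_sum_delta h) linear_sum; apply: eq_bigr => i _.
by rewrite linearZ /= mxE deriveE// mulrC.
Qed.

Lemma C11_expansion (y : 'rV[R]_m) (e : R) : 0 < e ->
  exists2 d : R, 0 < d & forall h, enorm h < d ->
    `|phi (y + h) - phi y - edot (grad phi y) h| <= e * enorm h.
Proof.
move=> e0; have [dphi _] := phiC11.
have /diff_locally/eqaddoP/(_ e e0)/nbhs_eballP[d d0 H] := dphi y.
exists d => // h hd; have : eball 0 d h by rewrite /eball /= subr0.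
move=> /H; rewrite -diff_grad /= !fctE /= [h + y]addrC opprD addrA => /le_trans; apply.
by rewrite ler_wpM2l ?(ltW e0)// norm_le_enorm.
Qed.

Lemma grad_bounded (r : R) : exists2 L : R, 0 <= L & forall y, enorm y < r -> enorm (grad phi y) <= L.
Proof.
have [_ [k kl]] := phiC11.
exists (m%:R * (`|grad phi 0| + `|k| * `|r|)).
  by rewrite mulr_ge0// addr_ge0// mulr_ge0.
move=> y yr; rewrite (le_trans (enorm_le_norm _))// ler_wpM2l//.
rewrite -(subrK (grad phi 0) (grad phi y)) (le_trans (ler_normD _ _))// addrC lerD2l.
have := kl (y, 0) (conj I I); rewrite /= => /le_trans; apply.
rewrite subr0 (@le_trans _ _ (`|k| * `|y|))//; first by rewrite ler_wpM2r// ler_norm.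
by rewrite ler_wpM2l// (le_trans (norm_le_enorm _))// (le_trans (ltW yr))// ler_norm.
Qed.

(** Mean value theorem on the segment from [y'] to [y]: the ball is convex, and the gradient is
    bounded on it. *)
Lemma C11_lipschitz (r : R) : exists2 L : R, 0 <= L & forall y y',
  enorm y < r -> enorm y' < r -> `|phi y - phi y'| <= L * enorm (y - y').
Proof.
have [L L0 Lr] := grad_bounded r; exists L => // y y' yr y'r.
pose v := y - y'.
pose f (s : R) := phi (y' + s *: v).
have df (s : R) : is_derive s 1 f (edot (grad phi (y' + s *: v)) v).
  have [dphi _] := phiC11.
  have E : (fun h : R => h^-1 *: ((f \o shift s) (h *: (1 : R)) - f s)) =
      (fun h : R => h^-1 *: ((phi \o shift (y' + s *: v)) (h *: v) - phi (y' + s *: v))).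
    apply/funext => h; rewrite /f /=; congr (_ *: (phi _ - _)).
    by rewrite [h%:A]mulr1 scalerDl addrCA.
  have dv : derivable phi (y' + s *: v) v by exact: diff_derivable.
  apply: DeriveDef; first by rewrite /derivable E.
  by rewrite /derive E -diff_grad -deriveE.
have [|s /[!in_itv]/= /andP[s0 s1]] := @MVT R f _ 0 1 ltr01 (fun s _ => df s).
  apply: continuous_subspaceT => s; apply: differentiable_continuous.
  by apply/derivable1_diffP; case: (df s).
rewrite /f scale1r scale0r addr0 (_ : y' + v = y); last by rewrite addrC subrK.
rewrite subr0 mulr1 => ->.
rewrite (le_trans (cauchy_schwarz _ _))// ler_wpM2r ?enorm_ge0//; apply: Lr.
have -> : y' + s *: (y - y') = (1 - s) *: y' + s *: y.
  by rewrite scalerBr scalerBl scale1r addrA addrAC.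
rewrite (le_lt_trans (enormD _ _))// !enormZ !ger0_norm ?subr_ge0 ?(ltW s0) ?(ltW s1)//.
rewrite (_ : r = (1 - s) * r + s * r); last by ring.
by rewrite ltrD// ltr_pM2l// subr_gt0.
Qed.

Lemma enorm_grad_continuous : continuous (fun y => enorm (grad phi y)).
Proof.
have [_ [k kl]] := phiC11.
apply: (@lipschitz_enorm_continuous _ _ _ (m%:R * `|k|)) => y y'.
rewrite (le_trans (enorm_lip _ _))// (le_trans (enorm_le_norm _))// -mulrA ler_wpM2l//.
have := kl (y, y') (conj I I); rewrite /= => /le_trans; apply.
rewrite (@le_trans _ _ (`|k| * `|y - y'|))//; first by rewrite ler_wpM2r// ler_norm.
by rewrite ler_wpM2l// norm_le_enorm.
Qed.

Definition area y := Num.sqrt (1 + enorm (grad phi y) ^+ 2).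

Lemma area_ge1 y : 1 <= area y.
Proof. by rewrite -[leLHS]sqrtr1 ler_sqrt ?lerDl ?sqr_ge0// addr_ge0// sqr_ge0. Qed.

Lemma area_continuous : continuous area.
Proof.
move=> y; apply: (continuous_comp (f := fun y => 1 + enorm (grad phi y) ^+ 2) (g := Num.sqrt)); last exact: sqrt_continuous.
apply: (@cvgD _ _ _ (nbhs y)); first exact: cvg_cst.
by apply: (@cvgM _ _ (nbhs y)); exact: enorm_grad_continuous.
Qed.

End c11.

Section cons_norm.
Context {R : realType} {m : nat}.
Implicit Types (t : R) (y p : 'rV[R]_m).

Lemma enorm_consE t y : enorm (cons_rV t y) = Num.sqrt (t ^+ 2 + enorm y ^+ 2).
Proof. by rewrite -enorm_cons sqrtr_sqr ger0_norm// enorm_ge0. Qed.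

Lemma enorm_cons_ge1 t y : `|t| <= enorm (cons_rV t y).
Proof. by rewrite enorm_consE -sqrtr_sqr ler_sqrt ?addr_ge0 ?sqr_ge0// lerDl sqr_ge0. Qed.

Lemma enorm_cons_ge2 t y : enorm y <= enorm (cons_rV t y).
Proof.
rewrite -[leLHS]ger0_norm ?enorm_ge0// enorm_consE -sqrtr_sqr.
by rewrite ler_sqrt ?addr_ge0 ?sqr_ge0// lerDr sqr_ge0.
Qed.

Lemma enorm_cons0 t : enorm (cons_rV t (0 : 'rV[R]_m)) = `|t|.
Proof. by rewrite enorm_consE enorm0 expr0n addr0 sqrtr_sqr. Qed.

(* The distance from (rho, 0) to the hyperplane {(p . h, h)}. *)
Lemma hyperplane_dist_ge (rho : R) p y : 0 <= rho ->
  rho / Num.sqrt (1 + enorm p ^+ 2) <= enorm (cons_rV (rho - edot p y) (- y)).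
Proof.
move=> rho0; rewrite enorm_consE enormN.
have w0 : 0 < 1 + enorm p ^+ 2 by rewrite ltr_pwDl// sqr_ge0.
rewrite ler_pdivrMr ?sqrtr_gt0// -sqrtrM ?addr_ge0 ?sqr_ge0//.
rewrite -[leLHS]ger0_norm// -sqrtr_sqr ler_sqrt ?mulr_ge0 ?addr_ge0 ?sqr_ge0//.
set a := rho - edot p y; have -> : rho = a + edot p y by rewrite /a subrK.
have pq := cauchy_schwarz p y.
have : (a + edot p y) ^+ 2 <= (`|a| + enorm p * enorm y) ^+ 2.
  rewrite -[leLHS]real_normK ?num_real// ler_sqr ?nnegrE ?addr_ge0 ?mulr_ge0 ?enorm_ge0//.
  by rewrite (le_trans (ler_normD _ _))// lerD2l.
move=> /le_trans; apply; rewrite -[a ^+ 2]real_normK ?num_real//.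
have := sqr_ge0 (`|a| * enorm p - enorm y); lra.
Qed.

(** This [y] is the foot of the perpendicular, at which the lower bound is attained. *)
Lemma hyperplane_dist_le (rho : R) p : 0 <= rho ->
  let y := (rho / (1 + enorm p ^+ 2)) *: p in
  enorm (cons_rV (rho - edot p y) (- y)) = rho / Num.sqrt (1 + enorm p ^+ 2).
Proof.
move=> rho0 y; have w0 : 0 < 1 + enorm p ^+ 2 by rewrite ltr_pwDl// sqr_ge0.
rewrite enorm_consE enormN /y edotZr edotxx enormZ exprMn real_normK ?num_real//.
set q := enorm p ^+ 2 in w0 *.
rewrite (_ : _ + _ = rho ^+ 2 / (1 + q)); last by field; rewrite gt_eqF.
by rewrite sqrtrM ?sqr_ge0// sqrtr_sqr ger0_norm// sqrtrV// ltW.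
Qed.

End cons_norm.

(** * Distance to the boundary inside a chart *)

Section local_chart.
Context {R : realType} {m : nat}.
Variables (Om : set 'rV[R]_m.+1) (c : 'rV[R]_m.+1) (r : R) (Q : 'M[R]_m.+1).
Variables (phi : 'rV[R]_m -> R).
Hypotheses (oOm : open Om) (chart : graph_chart Om c r Q phi).

Let QQ : Q *m Q^T = 1%:M. Proof. by case: chart. Qed.
Let phiC11 : C11 phi. Proof. by case: chart. Qed.

(** Here [t] is the absolute height in the frame, while [chart_map] measures heights from the
    graph. *)
Definition chart_pt (t : R) (y : 'rV[R]_m) := c + cons_rV t y *m Q^T.

Lemma chart_ptK t y : uncons_rV ((chart_pt t y - c) *m Q) = (t, y).
Proof. by rewrite /chart_pt addrC addKr -mulmxA (mulmx1C QQ) mulmx1 (cons_rVK (t, y)). Qed.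

Lemma chart_pt_surj x : exists t y, x = chart_pt t y.
Proof.
exists (uncons_rV ((x - c) *m Q)).1, (uncons_rV ((x - c) *m Q)).2.
by rewrite /chart_pt uncons_rVK -mulmxA QQ mulmx1 addrC subrK.
Qed.

Lemma chart_pt_dist t y t' y' :
  enorm (chart_pt t y - chart_pt t' y') = enorm (cons_rV (t - t') (y - y')).
Proof.
rewrite /chart_pt opprD addrACA subrr add0r -mulmxBl cons_rVN cons_rVD.
by rewrite enorm_mulmx// trmxK (mulmx1C QQ).
Qed.

Lemma chart_pt_center t y : enorm (chart_pt t y - c) = enorm (cons_rV t y).
Proof.
by rewrite /chart_pt addrC addKr enorm_mulmx// trmxK (mulmx1C QQ).
Qed.

Lemma chart_ptP t y : eball c r (chart_pt t y) -> (Om (chart_pt t y) <-> phi y < t).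
Proof. by case: chart => _ _ _ /(_ (chart_pt t y)) + xr => /(_ xr); rewrite chart_ptK. Qed.

Lemma chart_boundary t y :
  eball c r (chart_pt t y) -> (boundary Om (chart_pt t y) <-> t = phi y).
Proof.
move=> xr; split => [[clO]|tE].
  rewrite (interior_id Om).1// => nO.
  have tphi : t <= phi y by rewrite leNgt; apply/negP => /(chart_ptP xr).
  apply/eqP; rewrite eq_le tphi leNgt; apply/negP => tphi'.
  pose e := phi y - t.
  have /cvgrPdist_lt /(_ (e / 2)) := @C11_continuous _ _ _ phiC11 y.
  have e0 : 0 < e by rewrite subr_gt0.
  rewrite divr_gt0// => /(_ isT) /nbhs_eballP[d d0 phid].
  (* In this neighbourhood heights stay below t + e / 2 and [phi] stays above phi y - e / 2. The two
     numbers coincide, so it cannot meet Om. *)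
  have : nbhs (chart_pt t y) (eball c r `&` eball (chart_pt t y) (Num.min d (e / 2))).
    apply: open_nbhs_nbhs; split; first by apply: openI; exact: eball_open.
    by split => //; apply: eball_center; rewrite lt_min d0 divr_gt0.
  move=> /clO[x [Ox [xr' xd]]]; have [t' [y' xE]] := chart_pt_surj x.
  move: Ox xr' xd; rewrite xE => Ox xr'; rewrite /eball /= chart_pt_dist lt_min => /andP[dd de].
  have := (chart_ptP xr').1 Ox.
  have := phid y' (le_lt_trans (enorm_cons_ge2 _ _) dd).
  have := le_lt_trans (enorm_cons_ge1 _ _) de.
  rewrite /= !ltr_norml /e => /andP[h1 h2] /andP[h3 h4]; lra.
have nO : ~ Om (chart_pt t y) by move=> /(chart_ptP xr); rewrite tE ltxx.
split; last by rewrite (interior_id Om).1.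
move=> A /nbhs_eballP[e e0 eA].
have : nbhs (chart_pt t y) (eball c r).
  by apply: open_nbhs_nbhs; split => //; exact: eball_open.
move=> /nbhs_eballP[d d0 dr].
(* Lifting the graph point by a small [a] enters Om, which puts the graph into the closure. *)
pose a := Num.min d e / 2.
have a0 : 0 < a by rewrite divr_gt0// lt_min d0.
have [ad ae] : a < d /\ a < e.
  by rewrite /a; split; rewrite ltr_pdivrMr// gt_min; [apply/orP; left|apply/orP; right]; lra.
have xa : enorm (chart_pt (t + a) y - chart_pt t y) = a.
  by rewrite chart_pt_dist subrr addrC addKr enorm_cons0 gtr0_norm.
exists (chart_pt (t + a) y); split; last by apply: eA; rewrite /eball /= xa.
apply/chart_ptP; first by apply: dr; rewrite /eball /= xa.
by rewrite -tE ltrDl.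
Qed.

(** A boundary point closer than r - r' lies in the chart ball, hence on the graph, and the
    Lipschitz bound on [phi] controls the height difference; all others give the second term of the
    minimum. This linear bound will confine the rescaled layers to a bounded range of tau. *)
Lemma bdist_chart_ge (r' : R) : r' < r -> boundary Om !=set0 ->
  exists2 L : R, 0 < L & forall t y, enorm (chart_pt t y - c) <= r' -> phi y < t ->
    Num.min ((t - phi y) / L) (r - r') <= bdist Om (chart_pt t y).
Proof.
move=> r'r b0; have [L L0 Llip] := C11_lipschitz phiC11 r.
have L1 : 0 < L + 1 by rewrite ltr_wpDl.
exists (L + 1) => // t y tyr phit; apply: edist_ge => // z bz.
rewrite ge_min; have [xz|xz] := leP (r - r') (enorm (chart_pt t y - z)).
  by rewrite orbT.
rewrite orbF.
have [t' [y' zE]] := chart_pt_surj z.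
have zr : eball c r z.
  rewrite /eball /= (le_lt_trans (enorm_tri (chart_pt t y) z c))//.
  by rewrite enormB -(subrK r' r) ltr_leD.
move: bz zr xz; rewrite zE => bz zr xz.
have t'E := (chart_boundary zr).1 bz.
rewrite ler_pdivrMr// chart_pt_dist.
have yr : enorm y < r.
  by rewrite (le_lt_trans (enorm_cons_ge2 t y))// -chart_pt_center (le_lt_trans tyr).
have y'r : enorm y' < r.
  by rewrite (le_lt_trans (enorm_cons_ge2 t' y'))// -chart_pt_center.
have := Llip y y' yr y'r.
have h1 := le_trans (ler_norm _) (enorm_cons_ge1 (t - t') (y - y')).
have h2 := ler_wpM2l L0 (enorm_cons_ge2 (t - t') (y - y')).
rewrite ler_norml => /andP[h3 h4]; rewrite mulrDr mulr1 [_ * L]mulrC.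
rewrite t'E in h1 h2 *; lra.
Qed.

(** The graph is compared with its tangent hyperplane, at distance rho / area from the point. For
    the upper bound, the graph point over the foot of the perpendicular is a competitor. For the
    lower bound only boundary points closer than rho matter, and for these the Taylor remainder is
    at most e * rho. *)
Lemma bdist_chart_asymp y (e : R) : eball c r (chart_pt (phi y) y) -> 0 < e ->
  exists2 d : R, 0 < d & forall rho, 0 < rho -> rho < d ->
    `|bdist Om (chart_pt (phi y + rho) y) - rho / area phi y| <= e * rho.
Proof.
move=> yr e0.
have [d1 d10 expan] := C11_expansion phiC11 y e0.
have : nbhs (chart_pt (phi y) y) (eball c r).
  by apply: open_nbhs_nbhs; split => //; exact: eball_open.
move=> /nbhs_eballP[d2 d20 d2r].
have e4 : 0 < e + 4 by rewrite addr_gt0.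
(* The boundary points examined below lie within (e + 2) * rho of the graph point; dividing by e + 4
   keeps them in the chart ball. *)
exists (Num.min d1 (d2 / (e + 4))); first by rewrite lt_min d10 divr_gt0.
move=> rho rho0; rewrite lt_min => /andP[rd1]; rewrite ltr_pdivlMr// => rd2.
have erho : 0 < e * rho by rewrite mulr_gt0.
set x := chart_pt (phi y + rho) y.
set p := grad phi y.
have w1 : 1 <= area phi y := area_ge1 phi y.
have w0 : 0 < area phi y := lt_le_trans ltr01 w1.
have xy : enorm (x - chart_pt (phi y) y) = rho.
  by rewrite chart_pt_dist subrr addrC addKr enorm_cons0 gtr0_norm.
(* The vector to the graph point over y + h differs from the vector to the tangent hyperplane by the
   Taylor remainder, which is vertical. *)
have dec h : enorm (x - chart_pt (phi (y + h)) (y + h)) =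
    enorm (cons_rV (rho - edot p h) (- h) -
      cons_rV (phi (y + h) - phi y - edot p h) (0 : 'rV[R]_m)).
  rewrite chart_pt_dist cons_rVN cons_rVD; congr (enorm (cons_rV _ _)); first by ring.
  by rewrite oppr0 addr0 opprD addNKr.
rewrite ler_norml; apply/andP; split; last first.
  pose h := (rho / (1 + enorm p ^+ 2)) *: p.
  have hrho : enorm h <= rho.
    rewrite /h enormZ ger0_norm ?divr_ge0 ?(ltW rho0) ?addr_ge0 ?sqr_ge0//.
    rewrite mulrAC ler_pdivrMr ?ltr_pwDl ?sqr_ge0// ler_pM2l//.
    have := sqr_ge0 (enorm p - 1); have := enorm_ge0 p; lra.
  have he := expan h (le_lt_trans hrho rd1).
  have xz : enorm (x - chart_pt (phi (y + h)) (y + h)) <= rho / area phi y + e * rho.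
    rewrite dec (le_trans (enormD _ _))// enormN enorm_cons0 lerD//.
      by rewrite hyperplane_dist_le// ltW.
    by rewrite (le_trans he)// ler_wpM2l// ltW.
  rewrite lerBlDl (le_trans _ xz)//; apply: edist_le.
  have hd2 : eball c r (chart_pt (phi (y + h)) (y + h)).
    apply: d2r; rewrite /eball /=.
    rewrite (le_lt_trans (enorm_tri x _ _))// xy enormB.
    have : rho / area phi y <= rho by rewrite ler_pdivrMr// ler_peMr// ltW.
    lra.
  exact/chart_boundary.
rewrite lerBrDl; apply: edist_ge; first by exists (chart_pt (phi y) y); exact/chart_boundary.
move=> z bz; have [xz|xz] := leP rho (enorm (x - z)).
  rewrite (le_trans _ xz)// (@le_trans _ _ (rho / area phi y))//.
    by rewrite gerDl oppr_le0 mulr_ge0// ltW.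
  by rewrite ler_pdivrMr// ler_peMr// ltW.
have zr : eball c r z.
  apply: d2r; rewrite /eball /= (le_lt_trans (enorm_tri x _ _))// xy.
  by rewrite enormB; lra.
have [t' [y' zE]] := chart_pt_surj z.
have t'E : t' = phi y' by rewrite zE in bz zr; exact/chart_boundary.
pose h := y' - y.
have y'E : y' = y + h by rewrite addrC subrK.
move: xz; rewrite zE t'E y'E => xz.
have hrho : enorm h < rho.
  apply: le_lt_trans xz; rewrite /x chart_pt_dist.
  by rewrite (le_trans _ (enorm_cons_ge2 _ _))// opprD addNKr enormN.
have he := expan h (lt_trans hrho rd1).
rewrite dec.
have := enorm_lip (cons_rV (rho - edot p h) (- h)) (cons_rV (phi (y + h) - phi y - edot p h) (0 : 'rV[R]_m)).
have := hyperplane_dist_ge p h (ltW rho0); rewrite -/(area phi y).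
have := ler_wpM2l (ltW e0) (ltW hrho).
rewrite enorm_cons0 => h1 h2; rewrite ler_norml => /andP[h3 h4].
have := le_trans he h1; lra.
Qed.

End local_chart.

Lemma bounded_integrable_on d (T : measurableType d) (R : realType)
    (mu : {measure set T -> \bar R}) (E : set T) (M : R) (f : T -> R) :
  measurable E -> (mu E < +oo)%E -> measurable_fun setT f ->
  (forall x, `|f x| <= M * \1_E x) -> mu.-integrable setT (EFin \o f).
Proof.
move=> mE muE mf fM.
have : mu.-integrable setT (fun x => M%:E * (\1_E x)%:E)%E.
  apply: integrableZl => //; apply/integrableP; split; first exact/measurable_EFinP.
  under eq_integral do rewrite gee0_abs ?lee_fin//.
  by rewrite integral_indic// setIT.
apply: le_integrable => //; first exact/measurable_EFinP.
by move=> x _; rewrite -EFinM lee_fin (le_trans (fM x))// ler_norm.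
Qed.

Lemma integral_mrestr d (T : measurableType d) (R : realType)
    (mu : {measure set T -> \bar R}) (D : set T) (mD : measurable D) (f : T -> \bar R) :
  measurable_fun setT f ->
  (\int[mrestr mu mD]_x f x = \int[mu]_(x in D) f x)%E.
Proof.
move=> mf; rewrite -(setUv D) integral_setU//; first last.
- by rewrite /disj_set setICr.
- exact: measurable_funTS.
- exact: measurableC.
rewrite [X in (_ + X)%E]null_set_integral ?adde0//.
- by apply: eq_measure_integral => A mA AD; rewrite /= /mrestr setIidl.
- exact: measurableC.
- exact: measurable_funTS.
- by rewrite /= /mrestr setICl measure0.
Qed.

Section graph_null.
Context {R : realType} {m : nat}.
Local Notation lam := (@lebesgue_measure R \x lebesgue_rV m)%E.

(** The indicators of the rescaled layers may fail to converge on two graphs over y; their fibres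
    are single points, so Fubini makes them null. *)
Lemma graph_null (h : 'rV[R]_m -> R) : measurable_fun setT h ->
  lam.-negligible [set p | p.1 = h p.2].
Proof.
move=> mh.
have mG : measurable [set p : measurableTypeR R * 'rV[R]_m | p.1 = h p.2].
  rewrite (_ : [set p | _] = [set p : measurableTypeR R * 'rV[R]_m | [set 0] (p.1 - h p.2)]).
    apply: (measurable_preimage (f := fun p : measurableTypeR R * 'rV[R]_m => p.1 - h p.2)) => //.
    apply: measurable_funB; first exact: measurable_fst.
    exact: (measurableT_comp mh measurable_snd).
  by apply/seteqP; split=> p /=; [move=> ->; rewrite subrr|move/subr0_eq].
apply/negligibleP => //; rewrite [LHS](product_measure_yslice _ _ mG).
apply: integral0_eq => y _.
rewrite (_ : [set x | _] = [set h y]); first exact: lebesgue_measure_set1.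
by apply/seteqP; split.
Qed.

End graph_null.

Lemma layer_open (R : realType) n (Om : set 'rV[R]_n) j :
  open Om -> open (layer Om j).
Proof.
move=> oOm; rewrite (_ : layer Om j = Om `&` bdist Om @^-1` `]j%:R^-1, 2 / j%:R[).
  apply: openI => //; apply: open_comp; last exact: interval_open.
  by move=> x _; exact: edist_continuous.
by apply/seteqP; split => x; rewrite /layer /= in_itv.
Qed.

Lemma layer_measurable (R : realType) n (Om : set 'rV[R]_n) j :
  open Om -> measurable (layer Om j).
Proof. by move=> oOm; apply: open_measurable_rV; exact: layer_open. Qed.

(** * From layers to the surface measure *)

Section local_average.
Context {R : realType} {m : nat}.
Variables (Om : set 'rV[R]_m.+1) (sigma : {measure set 'rV[R]_m.+1 -> \bar R}).
Variables (c : 'rV[R]_m.+1) (r : R) (Q : 'M[R]_m.+1) (phi : 'rV[R]_m -> R).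
Hypotheses (oOm : open Om) (hsigma : surface_measure Om sigma).
Hypothesis (chart : graph_chart Om c r Q phi).
Local Notation lam := (@lebesgue_measure R \x lebesgue_rV m)%E.

Let QQ : Q *m Q^T = 1%:M. Proof. by case: chart. Qed.
Let phiC11 : C11 phi. Proof. by case: chart. Qed.
Let mphi : measurable_fun setT phi.
Proof. by apply: continuous_measurable_rV; exact: C11_continuous. Qed.

Definition slab : set (measurableTypeR R * 'rV[R]_m) :=
  [set p | area phi p.2 < p.1 < 2 * area phi p.2].

Let marea : measurable_fun setT (fun p : measurableTypeR R * 'rV[R]_m => area phi p.2).
Proof.
apply: measurableT_comp => //; apply: continuous_measurable_rV.
exact: area_continuous.
Qed.

Lemma slab_measurable : measurable slab.
Proof.
rewrite (_ : slab = [set p | `]0, +oo[%classic (p.1 - area phi p.2)] `&`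
    [set p | `]0, +oo[%classic (2 * area phi p.2 - p.1)]); last first.
  apply/seteqP; split=> p; rewrite /slab /= !in_itv /= !andbT !subr_gt0.
    by move=> /andP[].
  by case=> -> ->.
apply: measurableI.
  by apply: measurable_preimage => //; apply: measurable_funB => //; exact: measurable_fst.
by apply: measurable_preimage => //; apply: measurable_funB => //; apply: measurable_funM.
Qed.

Lemma measurable_graph_point : measurable_fun setT (graph_point c Q phi).
Proof.
apply: measurable_rVD => //; apply: measurable_mulmxr.
exact: measurable_fun_cons.
Qed.

Let mgraph2 : measurable_fun setT
  (fun p : measurableTypeR R * 'rV[R]_m => graph_point c Q phi p.2).
Proof. exact: (measurableT_comp measurable_graph_point measurable_snd). Qed.

(* The slab has height area y above y, which is the density of the surface measure. *)
Lemma surface_slab (B : set 'rV[R]_m.+1) : measurable B -> B `<=` eball c r ->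
  sigma B = lam (slab `&` [set p | B (graph_point c Q phi p.2)]).
Proof.
move=> mB Br; have [_ /(_ _ _ _ _ chart _ mB Br) ->] := hsigma.
have mS : measurable (slab `&` [set p | B (graph_point c Q phi p.2)]).
  by apply: measurableI; [exact: slab_measurable|exact: measurable_preimage mB].
rewrite (product_measure_yslice _ _ mS) integral_mkcond.
apply: eq_integral => y _; rewrite /patch.
have [By|By] := pselect ((graph_point c Q phi @^-1` B) y).
  rewrite mem_set//.
  have -> : [set x | (slab `&` [set p | B (graph_point c Q phi p.2)]) (x, y)] =
      [set` `]area phi y, 2 * area phi y[].
    apply/seteqP; split=> t; rewrite /slab /= in_itv /=; first by case.
    by move=> ->.
  have a0 : 0 < area phi y := lt_le_trans ltr01 (area_ge1 phi y).
  transitivity (lebesgue_measure (`]area phi y, 2 * area phi y[%classic : set R)) => //.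
  rewrite lebesgue_measure_itv /= lte_fin ltr_pMl// ltr1n -EFinD.
  by congr EFin; rewrite mulr2n mulrDl mul1r addrK.
rewrite memNset// (_ : [set x | _] = set0) ?measure0// -subset0 => t [_] /=.
exact: By.
Qed.

Lemma slab_ball_lty (r' : R) :
  (lam (slab `&` [set p | eball c r' (graph_point c Q phi p.2)]) < +oo)%E.
Proof.
have [L L0 Lr] := grad_bounded phiC11 r'.
(* On the ball, area = sqrt (1 + |grad|^2) <= 1 + L, so tau < 2 * area stays below W. *)
pose W := 2 * (1 + L).
have W0 : 0 <= W by rewrite mulr_ge0// addr_ge0.
have mB : measurable (slab `&` [set p | eball c r' (graph_point c Q phi p.2)]).
  by apply: measurableI; [exact: slab_measurable|apply: measurable_preimage (eball_measurable c r')].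
apply: (@le_lt_trans _ _ (lam (`[0, W]%classic `*` @cube R m (Num.max r' 0)))).
  apply: le_measure; rewrite ?inE//; first by apply: measurableX => //; exact: cube_measurable.
  move=> [t y] [/= /andP[t1 t2]]; rewrite /eball /= (chart_pt_center chart) => yr.
  have yr' := le_lt_trans (enorm_cons_ge2 _ _) yr.
  split; last by apply: enorm_sub_cube; rewrite /= le_max ltW.
  have a1 := area_ge1 phi y.
  have : area phi y <= 1 + L.
    rewrite -[leRHS]ger0_norm ?addr_ge0// -sqrtr_sqr ler_sqrt ?sqr_ge0//.
    have := Lr _ yr'; have := enorm_ge0 (grad phi y).
    move=> h1 h2; have := ler_pM h1 h1 h2 h2; rewrite -!expr2 sqrrD; lra.
  rewrite /= in t1 t2 * => aL; rewrite in_itv /= (le_trans _ (ltW t1)) ?(le_trans ler01 a1)//=.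
  by rewrite (le_trans (ltW t2))// ler_wpM2l.
rewrite [ltLHS]product_measure1E//; last exact: cube_measurable.
have r0 : 0 <= Num.max r' 0 by rewrite le_max lexx orbT.
have lW : lebesgue_measure (`[0%R, W]%classic : set R) = W%:E.
  rewrite lebesgue_measure_itv /= lte_fin oppr0 adde0.
  by case: ltP => // W0'; congr EFin; lra.
by rewrite [X in (_ * X)%E]lebesgue_rV_cube// [X in (X * _)%E]lW -EFinM ltry.
Qed.

Lemma surface_ball_lty : (sigma (eball c r) < +oo)%E.
Proof. by rewrite surface_slab//; [exact: slab_ball_lty|exact: eball_measurable]. Qed.

(** On the chart ball [sigma] is the image of [lam] restricted to the slab, which brings surface
    integrals to the space of the rescaled layer integrals. *)
Lemma ge0_integral_surface_slab (f : 'rV[R]_m.+1 -> \bar R) :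
  measurable_fun setT f -> (forall z, 0 <= f z)%E ->
  (forall z, ~ eball c r z -> f z = 0%E) ->
  (\int[sigma]_z f z = \int[lam]_(p in slab) f (graph_point c Q phi p.2))%E.
Proof.
move=> mf f_ge0 f0.
pose nu := image_measure (mrestr lam slab_measurable) mgraph2.
have restr (mu : {measure set 'rV[R]_m.+1 -> \bar R}) :
    (\int[mu]_z f z = \int[mu]_(z in eball c r) f z)%E.
  rewrite [RHS]integral_mkcond; apply: eq_integral => z _; rewrite /patch.
  by case: ifPn => //; rewrite notin_setE => /f0.
transitivity (\int[nu]_z f z)%E.
  rewrite !restr; apply: eq_measure_integral => A mA Ar.
  by rewrite surface_slab// image_measureE /= /mrestr setIC.
rewrite -(integral_mrestr _ slab_measurable); last exact: measurableT_comp.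
by rewrite [LHS]ge0_integral_pushforward// => z _; exact: f_ge0.
Qed.

Lemma integral_surface_slab (f : 'rV[R]_m.+1 -> \bar R) :
  measurable_fun setT f -> (forall z, ~ eball c r z -> f z = 0%E) ->
  (\int[sigma]_z f z = \int[lam]_(p in slab) f (graph_point c Q phi p.2))%E.
Proof.
move=> mf f0; rewrite [LHS]integralE [RHS]integralE.
rewrite ge0_integral_surface_slab//; first last.
- by move=> z /f0 fz; rewrite funeposE fz maxxx.
- exact: measurable_funepos.
rewrite ge0_integral_surface_slab//; last 2 first.
- exact: measurable_funeneg.
- by move=> z /f0 fz; rewrite funenegE fz oppe0 maxxx.
by congr (_ - _)%E; apply: eq_integral => p _; rewrite !(funeposE, funenegE).
Qed.

Hypothesis b0 : boundary Om !=set0.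
Variables (r' M : R) (g gb : 'rV[R]_m.+1 -> R).
Hypotheses (r'r : r' < r) (mg : measurable_fun setT g) (mgb : measurable_fun setT gb).
Hypothesis gM : forall x, `|g x| <= M.
Hypothesis g0 : forall x, r' < enorm (x - c) -> g x = 0.
Hypothesis gb0' : forall z, r' < enorm (z - c) -> gb z = 0.
Hypothesis ggb : forall z, boundary Om z -> g x @[x --> within Om (nbhs z)] --> gb z.

(* delta at the point of parameters (tau, y) is asymptotic to tau / (j * area y),
   so that the layer condition becomes area y < tau < 2 * area y in the limit. *)
Lemma layer_chart_cvg (tau : R) (y : 'rV[R]_m) :
  tau != area phi y -> tau != 2 * area phi y ->
  (g (chart_map c Q phi j%:R^-1 (tau, y)) *
    \1_(layer Om j) (chart_map c Q phi j%:R^-1 (tau, y))) @[j --> \oo] -->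
  \1_slab (tau, y) * gb (graph_point c Q phi y).
Proof.
move=> tw t2w.
have a1 := area_ge1 phi y; have a0 : 0 < area phi y := lt_le_trans ltr01 a1.
set P := graph_point c Q phi y.
set x := fun j : nat => chart_map c Q phi j%:R^-1 (tau, y).
have jP : \forall j \near \oo, 0 < j%:R^-1 :> R.
  by exists 1%N => // j /= j1; rewrite invr_gt0 ltr0n.
have small (e : R) : 0 < e -> \forall j \near \oo, `|tau| * j%:R^-1 < e.
  move=> e0; have e1 : 0 < e / (`|tau| + 1) by rewrite divr_gt0// ltr_pwDr.
  have := @near_infty_natSinv_lt R (PosNum e1); case=> k _ H.
  exists k.+1 => // -[//|j] /= kj; have /= := H j kj.
  rewrite ltr_pdivlMr ?ltr_pwDr// => H'; apply: le_lt_trans H'.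
  by rewrite mulrC ler_wpM2l ?invr_ge0// lerDl.
have xE j : x j = chart_pt c Q (phi y + tau / j%:R) y.
  by rewrite /x /chart_map /= mulrC.
have xP j : enorm (x j - P) = `|tau| * j%:R^-1.
  rewrite [x j]/(chart_pt c Q (phi y + j%:R^-1 * tau) y) [P]/(chart_pt c Q (phi y) y).
  rewrite (chart_pt_dist chart) subrr addrC addKr enorm_cons0 normrM mulrC.
  by rewrite [X in _ * X]ger0_norm// invr_ge0.
have xjP (e : R) : 0 < e -> \forall j \near \oo, enorm (x j - P) < e.
  by move=> /small; apply: filterS => j; rewrite xP.
(* If the graph point is outside the chart ball, the chart does not describe Om there, but both
   functions vanish beyond r' < r. *)
have [Pr|Pr] := leP r (enorm (P - c)).
  rewrite gb0' ?mulr0; last exact: lt_le_trans Pr.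
  apply: cvg_near_cst; have /xjP : 0 < r - r' by rewrite subr_gt0.
  apply: filterS => j xj; rewrite g0 ?mul0r//.
  have := enorm_tri (x j) P c; rewrite enormB in xj; lra.
have PE : P = chart_pt c Q (phi y) y by [].
have bP : boundary Om P by rewrite PE; exact/(chart_boundary oOm chart).
have xr : \forall j \near \oo, eball c r (x j).
  have /xjP : 0 < r - enorm (P - c) by rewrite subr_gt0.
  by apply: filterS => j xj; rewrite /eball /= (le_lt_trans (enorm_tri P _ _))// -ltrBrDr.
have Omx j : eball c r (x j) -> (Om (x j) <-> phi y < phi y + j%:R^-1 * tau).
  exact: (chart_ptP chart).
(* For tau <= 0 the points are on or below the graph, hence outside Om, and the slab lies above
   0. *)
have [tau0|tau0] := leP tau 0.
  rewrite [\1_slab _]indicE memNset ?mul0r; last first.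
    by move=> /andP[/= + _]; apply/negP; rewrite -leNgt (le_trans tau0)// ltW.
  apply: cvg_near_cst; apply: filterS xr => j xr; rewrite indicE memNset ?mulr0//.
  move=> [/(Omx _ xr) + _]; rewrite ltrDl; apply/negP; rewrite -leNgt.
  by rewrite mulr_ge0_le0// invr_ge0.
have asymp (e : R) : 0 < e -> \forall j \near \oo,
    `|bdist Om (x j) * j%:R - tau / area phi y| <= e.
  move=> e0; have et : 0 < e / tau by rewrite divr_gt0.
  have [d d0 H] := bdist_chart_asymp oOm chart Pr et.
  apply: filterS2 jP (small d d0) => j j0 jd.
  have j0' : 0 < j%:R :> R by rewrite -invr_gt0.
  have := H (j%:R^-1 * tau); rewrite mulr_gt0// => /(_ isT).
  rewrite mulrC -{1}(gtr0_norm tau0) => /(_ jd).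
  rewrite -xE mulrA divfK ?gt_eqF//.
  move=> H'.
  have -> : bdist Om (x j) * j%:R - tau / area phi y =
      (bdist Om (x j) - tau / j%:R / area phi y) * j%:R.
    by field; rewrite !gt_eqF.
  by rewrite normrM [X in _ * X]gtr0_norm// -ler_pdivlMr.
have xO : \forall j \near \oo, Om (x j).
  apply: filterS2 jP xr => j j0 xr; apply/(Omx _ xr).
  by rewrite ltrDl mulr_gt0.
have lay j : 0 < j%:R^-1 :> R -> Om (x j) ->
    layer Om j (x j) <-> 1 < bdist Om (x j) * j%:R < 2.
  move=> j0 Oj; have j0' : 0 < j%:R :> R by rewrite -invr_gt0.
  rewrite /layer /= ltr_pdivlMr// -[j%:R^-1]mul1r ltr_pdivrMr//.
  by split => [[]|].
have [tslab|tslab] := boolP (1 < tau / area phi y < 2).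
  rewrite indicE mem_set ?mul1r; last first.
    by move: tslab; rewrite /slab /= ltr_pdivlMr// ltr_pdivrMr// mul1r.
  apply/cvgrPdist_lt => e e0.
  have /nbhs_eballP[d d0 dg] : nbhs P [set x | Om x -> `|gb P - g x| < e].
    have /cvgrPdist_lt/(_ e e0) := ggb bP.
    by rewrite near_withinE.
  move: tslab => /andP[t1 t2].
  (* Half the smaller distance of tau / area from 1 and 2: an error of this size keeps j * delta
     between them. *)
  pose e' := Num.min (tau / area phi y - 1) (2 - tau / area phi y) / 2.
  have e'0 : 0 < e' by rewrite divr_gt0// lt_min !subr_gt0 t1.
  have [e'1 e'2] : e' < tau / area phi y - 1 /\ e' < 2 - tau / area phi y.
    rewrite /e'; split; rewrite ltr_pdivrMr// gt_min;
    by [apply/orP; left; lra|apply/orP; right; lra].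
  near=> j; rewrite indicE mem_set ?mulr1.
    apply: dg; first by near: j; exact: xjP.
    by near: j.
  apply/lay; [by near: j|by near: j|].
  have : `|bdist Om (x j) * j%:R - tau / area phi y| <= e' by near: j; exact: asymp.
  by rewrite ler_norml => /andP[h1 h2]; apply/andP; split; lra.
rewrite [\1_slab _]indicE memNset ?mul0r; last first.
  by move: tslab => /negP; rewrite /slab /= ltr_pdivlMr// ltr_pdivrMr// mul1r.
apply: cvg_near_cst.
(* The two values excluded for tau are the ones that would put tau / area at 1 or 2; away from them
   a margin outside [1, 2] is left. *)
have [e' e'0 He'] : exists2 e' : R, 0 < e' & tau / area phi y + e' < 1 \/ 2 < tau / area phi y - e'.
  have [t1|t1|t1] := ltgtP (tau / area phi y) 1.
  - exists ((1 - tau / area phi y) / 2); first by rewrite divr_gt0// subr_gt0.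
    by left; lra.
  - have [t2|t2|t2] := ltgtP (tau / area phi y) 2.
    + by rewrite t1 t2 in tslab.
    + exists ((tau / area phi y - 2) / 2); first by rewrite divr_gt0// subr_gt0.
      by right; lra.
    + by move: t2w; rewrite -t2 divfK ?eqxx// gt_eqF.
  - by move: tw; rewrite -[X in _ != X]mul1r -t1 divfK ?eqxx// gt_eqF.
near=> j; rewrite indicE memNset ?mulr0//.
have j0 : 0 < j%:R^-1 :> R by near: j.
have Oj : Om (x j) by near: j.
move=> /(lay _ j0 Oj)/andP[l1 l2].
have : `|bdist Om (x j) * j%:R - tau / area phi y| <= e' by near: j; exact: asymp.
by rewrite ler_norml => /andP[h1 h2]; case: He' => ?; lra.
Unshelve. all: by end_near. Qed.

Let f (j : nat) p := g (chart_map c Q phi j%:R^-1 p) *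
  \1_(layer Om j) (chart_map c Q phi j%:R^-1 p).

Let mf j : measurable_fun setT (f j).
Proof.
have mc := measurable_chart_map c Q j%:R^-1 mphi.
apply: measurable_funM; first exact: measurableT_comp.
by apply: measurableT_comp => //; apply: measurable_indic; exact: layer_measurable.
Qed.

(** On the layer delta < 2 / j, while the linear lower bound gives delta >= (tau / j) / L, whence
    tau <= 2 * L uniformly in large j. The support of [g] bounds y. *)
Lemma layer_chart_dominated : exists2 h : measurableTypeR R * 'rV[R]_m -> \bar R,
  lam.-integrable setT h & \forall j \near \oo, forall p, (`|(f j p)%:E| <= h p)%E.
Proof.
have [L L0 HL] := bdist_chart_ge oOm chart r'r b0.
have M0 : 0 <= M := le_trans (normr_ge0 _) (gM 0).
pose r0 := Num.max r' 0; have r00 : 0 <= r0 by rewrite le_max lexx orbT.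
pose E : set (measurableTypeR R * 'rV[R]_m) := `[0, 2 * L]%classic `*` @cube R m r0.
have mE : measurable E by apply: measurableX => //; exact: cube_measurable.
have lE : (lam E < +oo)%E.
  rewrite [ltLHS]product_measure1E//; last exact: cube_measurable.
  have lW : lebesgue_measure (`[0%R, 2 * L]%classic : set R) = (2 * L)%:E.
    by rewrite lebesgue_measure_itv /= lte_fin oppr0 adde0 mulr_gt0.
  by rewrite [X in (_ * X)%E]lebesgue_rV_cube// [X in (X * _)%E]lW -EFinM ltry.
exists (fun p => (M * \1_E p)%:E).
  have : lam.-integrable setT (fun p => M%:E * (\1_E p)%:E)%E.
    apply: integrableZl => //; apply/integrableP; split; first exact/measurable_EFinP.
    under eq_integral do rewrite gee0_abs ?lee_fin//.
    by rewrite integral_indic// setIT.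
  by congr integrable; apply/funext => p; rewrite EFinM.
(* Once 1 / j < (r - r') / 2, the alternative r - r' <= delta contradicts delta < 2 / j. *)
have rr : 0 < (r - r') / 2 by rewrite divr_gt0// subr_gt0.
have := @near_infty_natSinv_lt R (PosNum rr); case=> k _ H.
exists k.+1 => // -[//|j] /= kj [t y]; rewrite lee_fin.
have /= {}H := H j kj.
have j0 : 0 < j.+1%:R :> R by rewrite ltr0n.
rewrite /f; set x := chart_map _ _ _ _ _.
have [xl|xl] := pselect (layer Om j.+1 x); last first.
  by rewrite indicE memNset// mulr0 normr0 mulr_ge0.
have [xr|xr] := leP (enorm (x - c)) r'; last by rewrite g0// mul0r normr0 mulr_ge0.
suff Ep : E (t, y).
  by rewrite !indicE (mem_set xl) (mem_set Ep) !mulr1.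
have [Ox /andP[_ bx]] := xl.
have phit : phi y < phi y + j.+1%:R^-1 * t.
  by have /(chart_ptP chart) := Ox; apply; rewrite /eball /= (le_lt_trans xr).
have t0 : 0 < t by move: phit; rewrite ltrDl pmulr_rgt0// invr_gt0.
split => /=; last first.
  apply: enorm_sub_cube; rewrite /= le_max; apply/orP; left.
  by rewrite (le_trans _ xr)// (chart_pt_center chart) enorm_cons_ge2.
rewrite in_itv /= (ltW t0) /=.
have := HL _ _ xr phit; rewrite ge_min => /orP[].
  move=> /le_lt_trans /(_ bx); rewrite addrC addKr ltr_pdivrMr//.
  by rewrite mulrC -ltr_pdivlMr ?invr_gt0// invrK => /ltW /le_trans; apply; rewrite mulrAC divfK// gt_eqF.
move=> /le_lt_trans /(_ bx); rewrite ltr_pdivlMr// => h.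
by move: H; rewrite ltr_pdivlMr// mulrC -ltr_pdivlMr// => ?; exfalso; lra.
Qed.

(** The factor j cancels the slope 1 / j of the rescaled chart map, so the left-hand side is
    eventually the integral of [f j] over (tau, y). *)
Lemma local_layer_average :
  (j%:R%:E * \int[lebesgue_rV m.+1]_x (g x * \1_(layer Om j) x)%:E)%E @[j --> \oo] -->
  (\int[sigma]_z (gb z)%:E)%E.
Proof.
have [h inth [N _ fh]] := layer_chart_dominated.
have mgl j : measurable_fun setT (fun x => (g x * \1_(layer Om j) x)%:E).
  apply/measurable_EFinP; apply: measurable_funM => //.
  by apply: measurable_indic; exact: layer_measurable.
have intf j : (N <= j)%N -> lam.-integrable setT (EFin \o f j).
  move=> Nj; apply: (le_integrable measurableT _ _ inth).
    by apply/measurable_EFinP; exact: mf.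
  move=> p _; apply: le_trans (fh j Nj p) _.
  rewrite gee0_abs//; exact: le_trans (abse_ge0 _) (fh j Nj p).
pose F p := (\1_slab p * gb (graph_point c Q phi p.2))%:E.
have -> : (\int[sigma]_z (gb z)%:E = \int[lam]_p F p)%E.
  rewrite integral_surface_slab; first last.
  - move=> z zr; rewrite gb0'//; apply: lt_le_trans r'r _.
    by rewrite leNgt; apply/negP.
  - exact/measurable_EFinP.
  rewrite integral_mkcond; apply: eq_integral => p _; rewrite /F /patch indicE.
  by case: ifPn => _; rewrite ?mul1r ?mul0r.
(* Domination holds from N on only, hence the shifted sequence. *)
have [||//|||] := @dominated_convergence _ _ _ lam setT measurableT
  (fun n => EFin \o f (n + N)) F h.
- by move=> n; apply/measurable_EFinP; exact: mf.
- apply/measurable_EFinP; apply: measurable_funM; last exact: measurableT_comp.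
  by apply: measurable_indic; exact: slab_measurable.
- have marea' : measurable_fun setT (area phi).
    by apply: continuous_measurable_rV; exact: area_continuous.
  have n1 := graph_null marea'.
  have marea2 : measurable_fun setT (fun y => 2 * area phi y) by exact: measurable_funM.
  have n2 := graph_null marea2.
  apply: negligibleS (negligibleU n1 n2) => -[t y] /=.
  move=> /not_implyP[_ ncv]; apply: contrapT => /not_orP[/= t1 t2]; apply: ncv.
  rewrite (cvg_shiftn N (EFin \o (fun j => f j (t, y))) _).
  apply: cvg_EFin; first by apply: nearW.
  by apply: layer_chart_cvg; exact/eqP.
- exact: inth.
- by apply: aeW => p n _; apply: fh; rewrite /= leq_addl.
move=> _ _ H.
have {}H : (\int[lam]_p (f j p)%:E)%E @[j --> \oo] --> (\int[lam]_p F p)%E.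
  by rewrite -(cvg_shiftn N).
apply: cvg_trans H; apply: near_eq_cvg; exists N.+1 => // j /= Nj.
have j0 : 0 < j%:R^-1 :> R by rewrite invr_gt0 ltr0n (leq_ltn_trans _ Nj).
rewrite (@integral_chart _ _ c Q phi j%:R^-1)//; last by apply: intf; exact: ltnW.
by rewrite muleA -EFinM divff ?mul1e// -invr_eq0 gt_eqF.
Qed.

End local_average.

Lemma continuous_maxl (T : topologicalType) (R : realType) (a : R) (f : T -> R) :
  continuous f -> continuous (fun x => Num.max a (f x)).
Proof.
move=> cf x; apply/cvgrPdist_le => e e0; move/cvgrPdist_le: (cf x) => /(_ e e0).
apply: filterS => y; apply: le_trans.
rewrite !maxr_absE -mulrBl normrM [X in _ * X]gtr0_norm ?invr_gt0//.
rewrite ler_pdivrMr// (_ : _ - _ = (f x - f y) + (`|a - f x| - `|a - f y|)); last by ring.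
rewrite (le_trans (ler_normD _ _))// mulr_natr mulr2n lerD2l.
by rewrite (le_trans (ler_dist_dist _ _))// opprB addrC addrA subrK distrC.
Qed.

Section compact_positive.
Context {R : realType} {n : nat}.
Implicit Types (K Om : set 'rV[R]_n).

Lemma compact_lower_bound K (f : 'rV[R]_n -> R) :
  compact K -> continuous f -> (forall x, K x -> 0 < f x) ->
  exists2 d : R, 0 < d & forall x, K x -> d <= f x.
Proof.
move=> cK cf f0; have [->|/set0P K0] := eqVneq K set0; first by exists 1.
have [|x] := @compact_EVT_min _ _ f K K0 cK; first exact: continuous_subspaceT.
rewrite inE => Kx xmin; exists (f x); first exact: f0.
by move=> y Ky; apply: xmin; rewrite inE.
Qed.

Lemma compact_bdist Om K : boundary Om !=set0 -> compact K ->
  (forall x, K x -> ~ boundary Om x) ->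
  exists2 d : R, 0 < d & forall x, K x -> d <= bdist Om x.
Proof.
move=> b0 cK nK; apply: compact_lower_bound => //; first exact: edist_continuous.
by move=> x /nK; apply: edist_gt0 => //; exact: boundary_closed.
Qed.

Lemma natSinv_near (e : R) : 0 < e -> \forall j \near \oo, 0 < (j%:R^-1 : R) < e.
Proof.
move=> e0; have := @near_infty_natSinv_lt R (PosNum e0); case=> k _ H.
exists k.+1 => // -[//|j] /= kj; rewrite invr_gt0 ltr0n /=; exact: (H j kj).
Qed.

Lemma layer_far Om K : boundary Om !=set0 -> compact K ->
  (forall x, K x -> ~ boundary Om x) ->
  \forall j \near \oo, forall x, layer Om j x -> ~ K x.
Proof.
move=> b0 cK /(compact_bdist b0 cK)[d d0 dK].
have d2 : 0 < d / 2 by rewrite divr_gt0.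
apply: filterS (natSinv_near d2) => j /andP[_ jd] x [_ /andP[_ xj]] /dK dx.
by have := le_lt_trans dx xj; rewrite -ltr_pdivrMl// mulrC ltNge (ltW jd).
Qed.

End compact_positive.

(** * Finite atlas and finiteness of the surface measure *)

Section finite_surface.
Context {R : realType} {m : nat}.
Variables (Om : set 'rV[R]_m.+1) (sigma : {measure set 'rV[R]_m.+1 -> \bar R}).
Hypotheses (hOm : bounded_C11_domain Om) (hsigma : surface_measure Om sigma).

(** Covering by half the chart radii leaves a margin between the support of a weight and its chart
    ball. Setting [rad] to 0 off [s] makes the weights built from it vanish for all other
    centres. *)
Lemma finite_atlas : exists (s : seq 'rV[R]_m.+1) (rad : 'rV[R]_m.+1 -> R),
  (forall z, z \in s -> 0 < rad z /\ exists Q phi, graph_chart Om z (rad z) Q phi) /\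
  (forall z, z \notin s -> rad z = 0) /\
  (forall x, boundary Om x -> exists2 z, z \in s & enorm (x - z) < rad z / 2).
Proof.
have [_ _ _ bOm ch] := hOm.
have /choice[rad Hrad] : forall z, exists r, boundary Om z ->
    0 < r /\ exists Q phi, graph_chart Om z r Q phi.
  move=> z; have [/ch[r [Q [phi H]]]|nz] := pselect (boundary Om z).
    by exists r => _; split; [case: H|exists Q, phi].
  by exists 0 => /nz.
have := boundary_compact bOm; rewrite compact_cover.
move=> /(_ _ (boundary Om) (fun z => eball z (rad z / 2)))[].
- by move=> z _; exact: eball_open.
- move=> z bz; exists z => //; apply: eball_center.
  by rewrite divr_gt0//; case: (Hrad _ bz).
move=> D' D'b cov; pose s : seq 'rV[R]_m.+1 := finmap.enum_fset D'.
exists s, (fun z => if z \in s then rad z else 0); split; [|split] => z.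
- by move=> zs; rewrite zs; have := D'b z zs; rewrite inE => /Hrad.
- by move=> /negPf ->.
- by move=> /cov[y /= ys] xy; exists y => //; rewrite ys.
Qed.

(** Finitely many chart balls, each of finite mass, cover the boundary, and its complement is
    null. *)
Lemma surface_lty : (sigma setT < +oo)%E.
Proof.
have [_ oOm _ _ _] := hOm.
have [s [rad [Hs [_ cov]]]] := finite_atlas.
have [U mU Ulty] : exists2 U, measurable U & (sigma U < +oo)%E /\
    forall x, (exists2 z, z \in s & enorm (x - z) < rad z / 2) -> U x.
  elim: s Hs {cov} => [|z s IH] Hs; first by exists set0; rewrite ?measure0//; split => // x [].
  have [|U mU [Ulty UP]] := IH; first by move=> y ys; apply: Hs; rewrite inE ys orbT.
  have [rz [Q [phi ch]]] := Hs z (mem_head _ _).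
  exists (eball z (rad z) `|` U); first by apply: measurableU => //; exact: eball_measurable.
  split.
    apply: (le_lt_trans (measureU2 _ (eball_measurable _ _) mU)).
    by rewrite lte_add_pinfty//; exact: surface_ball_lty hsigma ch.
  move=> x [y]; rewrite inE => /predU1P[->|ys] xy; [left|right].
    by apply: lt_trans xy _; rewrite ltr_pdivrMr//; lra.
  by apply: UP; exists y.
have [Ulty' UP] := Ulty.
have mb : measurable (boundary Om) by apply: closed_measurable_rV; exact: boundary_closed.
apply: (@le_lt_trans _ _ (sigma (U `|` ~` boundary Om))).
  apply: le_measure; rewrite ?inE//; first by apply: measurableU => //; exact: measurableC.
  move=> x _; have [bx|nx] := pselect (boundary Om x); [left|by right].
  exact/UP/cov.
apply: (le_lt_trans (measureU2 _ mU (measurableC mb))).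
by have [s0 _] := hsigma; rewrite [X in (_ + X)%E]s0 adde0.
Qed.

End finite_surface.

(** * Partition of unity *)

Section layer_average.
Context {R : realType} {m : nat}.
Variables (Om : set 'rV[R]_m.+1) (sigma : {measure set 'rV[R]_m.+1 -> \bar R}).
Hypotheses (hOm : bounded_C11_domain Om) (hsigma : surface_measure Om sigma).
Hypothesis b0 : boundary Om !=set0.
Variables (M : R) (h hb : 'rV[R]_m.+1 -> R).
Hypotheses (mh : measurable_fun setT h) (mhb : measurable_fun setT hb).
Hypotheses (hM : forall x, `|h x| <= M) (hbM : forall x, `|hb x| <= M).
Hypothesis hb0 : forall z, ~ boundary Om z -> hb z = 0.
Hypothesis hhb : forall z, boundary Om z -> h x @[x --> within Om (nbhs z)] --> hb z.

Let oOm : open Om. Proof. by case: hOm. Qed.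
Let bOm : bounded_set Om. Proof. by case: hOm. Qed.
Let M0 : 0 <= M := le_trans (normr_ge0 _) (hM 0).

Lemma layer_lty j : (lebesgue_rV m.+1 (layer Om j) < +oo)%E.
Proof.
have [B _ HB] := bounded_eballP bOm.
apply: (@lebesgue_rV_bounded _ _ _ B); first exact: layer_measurable.
by move=> x [/HB].
Qed.

Lemma bounded_layer_integrable (g : 'rV[R]_m.+1 -> R) j : measurable_fun setT g ->
  (forall x, `|g x| <= M) ->
  (lebesgue_rV m.+1).-integrable setT (fun x => (g x * \1_(layer Om j) x)%:E).
Proof.
move=> mg gM; apply: (@bounded_integrable_on _ _ _ _ (layer Om j) M).
- exact: layer_measurable.
- exact: layer_lty.
- by apply: measurable_funM => //; apply: measurable_indic; exact: layer_measurable.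
- by move=> x; rewrite normrM [X in _ * X]ger0_norm// ler_wpM2r.
Qed.

Lemma bounded_surface_integrable (g : 'rV[R]_m.+1 -> R) : measurable_fun setT g ->
  (forall x, `|g x| <= M) -> sigma.-integrable setT (EFin \o g).
Proof.
move=> mg gM; apply: measurable_bounded_integrable => //.
  exact: surface_lty hOm hsigma.
by exists M; split; [exact: num_real|move=> t Mt x _ /=; rewrite (le_trans (gM x))// ltW].
Qed.

Lemma layer_average :
  (j%:R%:E * \int[lebesgue_rV m.+1]_x (h x * \1_(layer Om j) x)%:E)%E @[j --> \oo] -->
  (\int[sigma]_z (hb z)%:E)%E.
Proof.
have [s [rad [Hs [Hns cov]]]] := finite_atlas hOm.
(* Tents on the half balls: by the cover their sum is positive on the boundary, and by compactness
   bounded below there. *)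
pose th z x := Num.max 0 (rad z / 2 - enorm (x - z)).
have th0 z x : 0 <= th z x by rewrite le_max lexx.
have cth z : continuous (th z).
  apply: continuous_maxl => x.
  apply: (@cvgB _ _ _ (nbhs x)); first exact: cvg_cst.
  have cz : continuous (fun x : 'rV[R]_m.+1 => enorm (x - z)); last exact: cz.
  apply: lip_continuous => a b; rewrite (le_trans (enorm_lip _ _))//.
  by rewrite (_ : _ - _ = a - b)// opprB addrA subrK.
pose Th x := \sum_(z <- s) th z x.
have cTh : continuous Th.
  rewrite /Th; elim: (s) => [|z s' IH].
    rewrite (_ : (fun _ => _) = fun=> 0); first by move=> x; exact: cst_continuous.
    by apply/funext => x; rewrite big_nil.
  rewrite (_ : (fun _ => _) = fun x => th z x + \sum_(y <- s') th y x).
    by move=> x; apply: (@cvgD _ _ _ (nbhs x)); [exact: cth|exact: IH].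
  by apply/funext => x; rewrite big_cons.
have Thb x : boundary Om x -> 0 < Th x.
  move=> /cov[z zs xz]; rewrite /Th (big_rem z)//=.
  rewrite ltr_pwDl ?sumr_ge0// /th lt_max subr_gt0 xz orbT//.
have [k k0 kTh] := compact_lower_bound (boundary_compact bOm) cTh Thb.
(* W stays positive away from the boundary; the weights q z = th z / W add up to
   one where Th >= k / 2, hence on the boundary and on all thin layers. *)
pose W x := Num.max (k / 2) (Th x).
have k2 : 0 < k / 2 by rewrite divr_gt0.
have W0 x : 0 < W x by rewrite lt_max k2.
have cW : continuous W.
  exact: continuous_maxl.
pose q z x := th z x / W x.
have cq z : continuous (q z).
  move=> x; apply: (@cvgM _ _ (nbhs x)); first exact: cth.
  by apply: (@cvgV _ _ (nbhs x)); [rewrite gt_eqF|exact: cW].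
have mq z : measurable_fun setT (q z) by exact: continuous_measurable_rV.
have q0 z x : 0 <= q z x by rewrite divr_ge0// ltW.
have q1 z x : q z x <= 1.
  have [zs|/Hns zs] := boolP (z \in s); last first.
    rewrite /q /th zs mul0r sub0r max_l ?mul0r// oppr_le0; exact: enorm_ge0.
  rewrite ler_pdivrMr// mul1r le_max; apply/orP; right.
  by rewrite /Th (big_rem z)//= lerDl sumr_ge0.
have qM z (f : 'rV[R]_m.+1 -> R) : (forall x, `|f x| <= M) ->
    forall x, `|f x * q z x| <= M.
  move=> fM x; rewrite normrM (ger0_norm (q0 z x)) -[M]mulr1.
  by rewrite ler_pM ?q1.
have sumq x : k / 2 <= Th x -> \sum_(z <- s) q z x = 1.
  move=> kx; rewrite -mulr_suml -/(Th x) /W max_r// divff// gt_eqF//.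
  exact: lt_le_trans kx.
have qfar z x : rad z / 2 < enorm (x - z) -> q z x = 0.
  by move=> xz; rewrite /q /th max_l ?mul0r// subr_le0 ltW.
have loc z : z \in s ->
    (j%:R%:E * \int[lebesgue_rV m.+1]_x (h x * q z x * \1_(layer Om j) x)%:E)%E @[j --> \oo] -->
    (\int[sigma]_x (hb x * q z x)%:E)%E.
  move=> zs; have [rz [Q [phi ch]]] := Hs z zs.
  apply: (@local_layer_average _ _ Om sigma z (rad z) Q phi oOm hsigma ch b0 (rad z / 2) M) => //.
  - by rewrite ltr_pdivrMr//; lra.
  - exact: measurable_funM.
  - exact: measurable_funM.
  - exact: qM.
  - by move=> x /qfar ->; rewrite mulr0.
  - by move=> x /qfar ->; rewrite mulr0.
  - move=> x bx; apply: (@cvgM _ _ (within Om (nbhs x))); first exact: hhb.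
    by apply: cvg_within_filter; exact: cq.
have inthb z : sigma.-integrable setT (EFin \o (fun x => hb x * q z x)).
  apply: bounded_surface_integrable; last exact: qM.
  exact: measurable_funM.
have inth j z : (lebesgue_rV m.+1).-integrable setT
    (fun x => (h x * q z x * \1_(layer Om j) x)%:E).
  apply: bounded_layer_integrable; last exact: qM.
  exact: measurable_funM.
have -> : (\int[sigma]_z (hb z)%:E = \sum_(z <- s) \int[sigma]_x (hb x * q z x)%:E)%E.
  rewrite -(integral_sum measurableT inthb); apply: eq_integral => x _ /=.
  rewrite sumEFin -mulr_sumr; have [bx|nx] := pselect (boundary Om x).
    rewrite sumq ?mulr1// (le_trans _ (kTh x bx))// ler_pdivrMr//; lra.
  by rewrite hb0// mul0r.
have H : (\sum_(z <- s) (j%:R%:E * \int[lebesgue_rV m.+1]_x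
     (h x * q z x * \1_(layer Om j) x)%:E))%E @[j --> \oo] -->
     (\sum_(z <- s) \int[sigma]_x (hb x * q z x)%:E)%E.
  (* The local limits are available for centres in [s] only, so the induction runs over lists of
     elements of [s]. *)
  have : {subset s <= s} by [].
  elim: {-2}s => [|z s' IH] ss'.
    by under eq_fun do rewrite big_nil; rewrite big_nil; exact: cvg_cst.
  under eq_fun do rewrite big_cons; rewrite big_cons; apply: cvgeD.
  - by apply: fin_num_adde_defr; apply: integrable_fin_num => //; exact: inthb.
  - by apply: loc; apply: ss'; exact: mem_head.
  - by apply: IH => y ys; apply: ss'; rewrite inE ys orbT.
apply: cvg_trans H; apply: near_eq_cvg.
(* In the closure of Om the weights can fail to add up to one only on this set. It is compact and
   avoids the boundary, where Th >= k, so thin layers do not meet it. *)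
pose C := closure Om `&` [set x | Th x <= k / 2].
have cC : compact C.
  apply: bounded_closed_compact.
    have /bounded_eballP[B _ HB] := closure_bounded bOm.
    by apply: (@eball_bounded _ _ _ B) => x [/HB].
  apply: closedI; first exact: closed_closure.
  by apply: (@closed_comp _ _ Th [set t | t <= k / 2]); [move=> x _; exact: cTh|exact: closed_le].
have Cb x : C x -> ~ boundary Om x.
  by move=> [_ Cx] /kTh /le_trans/(_ Cx); rewrite leNgt ltr_pdivrMr//; lra.
apply: filterS (layer_far b0 cC Cb) => j Hj.
under eq_bigr do rewrite -integralZl//.
rewrite -integralZl//; last exact: bounded_layer_integrable.
rewrite -(integral_sum measurableT (fun z => integrableZl measurableT _ (inth j z))).
apply: eq_integral => x _; rewrite indicE; have [xl|xl] := boolP (x \in layer Om j).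
  under eq_bigr do rewrite mulr1 -EFinM mulrA.
  rewrite sumEFin -mulr_sumr sumq ?mulr1 ?EFinM// leNgt; apply/negP => /ltW Cx.
  move: xl; rewrite inE => xl; apply: (Hj x xl); split => //.
  by apply: subset_closure; case: xl.
rewrite mulr0 mule0 big1// => z _; by rewrite mulr0 mule0.
Qed.

End layer_average.

(** The first coordinate attains its maximum over the compact closure, and it cannot do so at an
    interior point. *)
Lemma boundary_neq0 (R : realType) m (Om : set 'rV[R]_m.+1) :
  Om !=set0 -> bounded_set Om -> boundary Om !=set0.
Proof.
move=> [x Ox] bOm.
have cc : compact (closure Om).
  by apply: bounded_closed_compact; [exact: closure_bounded|exact: closed_closure].
have [||x0 + x0max] := @compact_EVT_max _ _ (fun v : 'rV[R]_m.+1 => v ord0 ord0) (closure Om) _ cc.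
- by exists x; exact: subset_closure.
- by apply: continuous_subspaceT => v; exact: coord_continuous.
rewrite inE => clx0; exists x0; split => //.
move=> /nbhs_eballP[e e0 eOm].
pose y := x0 + cons_rV (e / 2) (0 : 'rV[R]_m).
have e2 : 0 < e / 2 by rewrite divr_gt0.
have Oy : Om y.
  apply: eOm; rewrite /eball /= /y addrC addKr enorm_cons0 gtr0_norm//.
  by rewrite ltr_pdivrMr//; lra.
have := x0max y; rewrite inE => /(_ (subset_closure Oy)).
by rewrite mxE cons_rV0; lra.
Qed.

Section sequences_in_domain.
Context {R : realType} {n : nat}.
Implicit Types (Om : set 'rV[R]_n) (z : 'rV[R]_n).

Lemma cvg_seq_enorm (x_ : nat -> 'rV[R]_n) z :
  (forall e : R, 0 < e -> \forall j \near \oo, enorm (x_ j - z) < e) ->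
  x_ j @[j --> \oo] --> z.
Proof.
move=> H; apply/cvgrPdist_lt => e e0; apply: filterS (H e e0) => j.
by apply: le_lt_trans; rewrite distrC; exact: norm_le_enorm.
Qed.

Lemma closure_seq Om z : closure Om z ->
  exists2 x_ : nat -> 'rV[R]_n, forall j, Om (x_ j) & x_ j @[j --> \oo] --> z.
Proof.
move=> clz.
have /choice[x_ Hx] : forall j : nat, exists x, Om x /\ enorm (x - z) < j.+1%:R^-1.
  move=> j; have : nbhs z (eball z j.+1%:R^-1).
    by apply/nbhs_eballP; exists j.+1%:R^-1 => //; rewrite invr_gt0 ltr0n.
  by move=> /clz[x [Ox xz]]; exists x.
exists x_ => [j|]; first by case: (Hx j).
apply: cvg_seq_enorm => e e0; have := @near_infty_natSinv_lt R (PosNum e0).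
by apply: filterS => j; apply: lt_trans; case: (Hx j).
Qed.

(** The hypothesis on D and dominated convergence are both sequential; this leads back from
    sequences in Om to the limit within Om. *)
Lemma cvg_within_seq Om z (f : 'rV[R]_n -> R) (l : R) :
  (forall x_ : nat -> 'rV[R]_n, (forall j, Om (x_ j)) -> x_ j @[j --> \oo] --> z ->
     f (x_ j) @[j --> \oo] --> l) ->
  f x @[x --> within Om (nbhs z)] --> l.
Proof.
move=> H; apply/cvgrPdist_lt => e e0; rewrite near_withinE; apply: contrapT => nH.
have /choice[x_ Hx] : forall j : nat, exists x,
    [/\ Om x, enorm (x - z) < j.+1%:R^-1 & ~ `|l - f x| < e].
  move=> j; apply: contrapT => nx; apply: nH; apply/nbhs_eballP.
  exists j.+1%:R^-1; first by rewrite invr_gt0 ltr0n.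
  by move=> x xz Ox; apply: contrapT => fx; apply: nx; exists x.
have xz : x_ j @[j --> \oo] --> z.
  apply: cvg_seq_enorm => d d0; have := @near_infty_natSinv_lt R (PosNum d0).
  by apply: filterS => j; apply: lt_trans; case: (Hx j).
have /cvgrPdist_lt/(_ e e0)[N _ HN] := H x_ (fun j => let: And3 a _ _ := Hx j in a) xz.
by case: (Hx N) => _ _; apply; apply: HN => /=.
Qed.

End sequences_in_domain.

Lemma integrable_fubini_G d1 d2 (T1 : measurableType d1) (T2 : measurableType d2)
    (R : realType) (m1 : {sigma_finite_measure set T1 -> \bar R})
    (m2 : {sigma_finite_measure set T2 -> \bar R}) (f : T1 * T2 -> \bar R) :
  (m1 \x m2)%E.-integrable setT f -> m2.-integrable setT (fubini_G m1 f).
Proof.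
move=> intf; have mf : measurable_fun setT f by case/integrableP: intf.
apply/integrableP; split; first exact: measurable_fubini_G intf.
have /(integrable21ltyP _ _ mf) := intf; apply: le_lt_trans.
apply: ge0_le_integral => //.
- by apply: measurableT_comp => //; exact: measurable_fubini_G intf.
- apply: (@measurable_fun_fubini_tonelli_G _ _ _ _ _ m1 (fun p => `|f p|%E)) => //.
  exact: measurableT_comp.
- move=> y _; apply: le_abse_integral => //.
  exact: (measurableT_comp mf (measurable_pair2 y)).
Qed.

(** * Green potentials near the boundary *)

Section green_bound.
Context {R : realType} {m : nat}.
Variables (Om : set 'rV[R]_m.+1) (s gamma : R) (G : 'rV[R]_m.+1 -> 'rV[R]_m.+1 -> R).
Hypotheses (oOm : open Om) (bOm : bounded_set Om) (b0 : boundary Om !=set0).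
Hypothesis hG : green_kernel Om s gamma G.

Lemma bdist_bounded : exists2 B : R, 0 < B & forall x, Om x -> bdist Om x <= B.
Proof.
have /bounded_eballP[B B0 HB] := closure_bounded bOm.
have [z0 bz0] := b0.
exists (B + B) => [|x Ox]; first exact: addr_gt0.
rewrite (le_trans (edist_le x bz0))// (le_trans (enormD _ _))// enormN.
by rewrite lerD// HB//; [exact: subset_closure|case: bz0].
Qed.

(** If delta >= d on K and e = d / 2, the Lipschitz property of delta keeps x and y at least e
    apart. The first factor of the profile is then bounded because n - 2 * s >= 0, and the minimum
    is at most a constant times delta x, since delta y is bounded. *)
Lemma green_bound K : compact K -> K `<=` Om ->
  exists e A : R, [/\ 0 < e, 0 <= A, forall x, K x -> ~ bdist Om x <= e &
    forall x y, Om x -> K y -> bdist Om x <= e -> 0 <= G x y <= A * bdist Om x `^ gamma].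
Proof.
move=> cK KOm; have [[sg gg sn] [_ _ [C [C0 HC]]]] := hG.
have [d d0 dK] := compact_bdist b0 cK (fun x Kx => boundary_open oOm (KOm x Kx)).
have [B B0 HB] := bdist_bounded.
pose eta := d / 2; have eta0 : 0 < eta by rewrite divr_gt0.
exists eta, (C * ((eta `^ (m.+1%:R - 2 * s))^-1 * (B / eta ^+ 2) `^ gamma)); split => //.
- by rewrite !mulr_ge0 ?invr_ge0 ?powR_ge0// ltW.
- by move=> x /dK dx; apply/negP; rewrite -ltNge (lt_le_trans _ dx)// /eta ltr_pdivrMr//; lra.
move=> x y Ox Ky xe.
have xy : eta <= enorm (x - y).
  have := edist_lip (boundary Om) x y; rewrite ler_norml => /andP[h1 _].
  have := dK y Ky; rewrite -/(bdist Om _) -/(bdist Om _) in h1; rewrite /eta in xe *; lra.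
have xny : x != y by apply: contraTneq xy => ->; rewrite subrr enorm0 -ltNge.
have /andP[G1 G2] := HC x y Ox (KOm y Ky) xny.
have prof0 : 0 <= green_profile Om s gamma x y.
  by rewrite mulr_ge0 ?invr_ge0 ?powR_ge0.
apply/andP; split; first by rewrite (le_trans _ G1)// mulr_ge0// invr_ge0 ltW.
rewrite (le_trans G2)// -mulrA ler_pM2l//.
rewrite /green_profile -[leRHS]mulrA; apply: ler_pM; rewrite ?invr_ge0 ?powR_ge0//.
  rewrite lef_pV2 ?posrE ?powR_gt0// ?(lt_le_trans eta0)//.
  by apply: ge0_ler_powR; rewrite ?nnegrE ?subr_ge0// ltW// (lt_le_trans eta0).
have dx0 := edist_ge0 (boundary Om) x; have dy0 := edist_ge0 (boundary Om) y.
rewrite -/(bdist Om x) in dx0; rewrite -/(bdist Om y) in dy0.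
have Be : 0 <= B / eta ^+ 2 by rewrite divr_ge0 ?sqr_ge0// ltW.
rewrite -powRM//; apply: ge0_ler_powR; rewrite ?nnegrE; first by case/andP: gg => /ltW.
- by rewrite le_min ler01 andbT; apply: divr_ge0; [exact: mulr_ge0|exact: sqr_ge0].
- by rewrite mulr_ge0.
rewrite ge_min; apply/orP; left.
have -> : B / eta ^+ 2 * bdist Om x = bdist Om x * B / eta ^+ 2 by rewrite mulrC mulrA.
apply: ler_pM; rewrite ?mulr_ge0 ?invr_ge0 ?sqr_ge0//.
  by rewrite ler_wpM2l// HB//; exact: KOm.
rewrite lef_pV2 ?posrE ?exprn_gt0// ?(lt_le_trans eta0)//.
by rewrite lerXn2r// nnegrE// ltW// (lt_le_trans eta0).
Qed.

End green_bound.

(** * Boundary quotients of the potential of a test function *)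

Section potential.
Context {R : realType} {m : nat}.
Local Notation T := 'rV[R]_m.+1.
Local Notation leb := (@lebesgue_rV R m.+1).
Variables (Om : set T) (gamma : R) (G D : T -> T -> R).
Hypotheses (oOm : open Om) (bOm : bounded_set Om) (b0 : boundary Om !=set0).
Hypothesis mG : measurable_fun (Om `*` Om) (fun p : T * T => G p.1 p.2).
Hypothesis hD : kernel_normal_derivative Om gamma G D.
Variables (K : set T) (e A : R).
Hypotheses (cK : compact K) (KOm : K `<=` Om) (e0 : 0 < e) (A0 : 0 <= A).
Hypothesis GA : forall x y, Om x -> K y -> bdist Om x <= e ->
  0 <= G x y <= A * bdist Om x `^ gamma.
Variables (psi : T -> R) (Mp : R).
Hypotheses (mpsi : measurable_fun setT psi) (psiM : forall y, `|psi y| <= Mp).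
Hypothesis psi0 : forall y, ~ K y -> psi y = 0.

Let mOm : measurable Om. Proof. exact: open_measurable_rV. Qed.
Let mK : measurable K. Proof. exact: compact_measurable_rV. Qed.
Let mb : measurable (boundary Om).
Proof. by apply: closed_measurable_rV; exact: boundary_closed. Qed.
Let Mp0 : 0 <= Mp := le_trans (normr_ge0 _) (psiM 0).
Let AM0 : 0 <= A * Mp. Proof. exact: mulr_ge0. Qed.

Lemma bounded_lty (E : set T) : measurable E -> E `<=` Om -> (leb E < +oo)%E.
Proof.
move=> mE EOm; have [B _ HB] := bounded_eballP bOm.
by apply: (@lebesgue_rV_bounded _ _ _ B) => // x /EOm/HB.
Qed.

Definition strip : set T := Om `&` [set x | bdist Om x <= e].

Lemma strip_measurable : measurable strip.
Proof.
apply: measurableI => //; apply: closed_measurable_rV.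
apply: (@closed_comp _ _ (bdist Om) [set t | t <= e]); last exact: closed_le.
by move=> x _; exact: edist_continuous.
Qed.

Lemma bdist_pow_gt0 x : Om x -> 0 < bdist Om x `^ gamma.
Proof. by move=> Ox; apply: powR_gt0; exact: bdist_gt0. Qed.

(* The cutoff to the strip, harmless for the limit at the boundary, makes the
   quotient G(x,y) psi(y) / delta(x)^gamma bounded. *)
Definition ker (p : T * T) : R :=
  ((fun p : T * T => G p.1 p.2) \_ (Om `*` Om)) p * psi p.2 *
  \1_strip p.1 * bdist Om p.1 `^ (- gamma).

Lemma measurable_ker : measurable_fun setT ker.
Proof.
apply: measurable_funM; first apply: measurable_funM; first apply: measurable_funM.
- by apply/measurable_restrict => //; [exact: measurableX|rewrite setTI].
- exact: (measurableT_comp mpsi measurable_snd).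
- apply: (measurableT_comp _ measurable_fst).
  by apply: measurable_indic; exact: strip_measurable.
- apply: (measurableT_comp (measurable_powR _)).
  apply: (measurableT_comp _ measurable_fst).
  by apply: continuous_measurable_rV; exact: edist_continuous.
Qed.

Lemma kerE x y : strip x -> Om y -> ker (x, y) = G x y * psi y / bdist Om x `^ gamma.
Proof.
move=> sx Oy; have [Ox _] := sx.
by rewrite /ker /= /patch mem_set// indicE mem_set//= mulr1 powRN.
Qed.

Lemma ker_out x y : ~ strip x -> ker (x, y) = 0.
Proof. by move=> nx; rewrite /ker /= indicE memNset// mulr0 mul0r. Qed.

Lemma ker_out_psi x y : ~ K y -> ker (x, y) = 0.
Proof. by move=> nx; rewrite /ker /= psi0// mulr0 !mul0r. Qed.

Lemma ker_le x y : `|ker (x, y)| <= A * Mp * \1_K y.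
Proof.
have rhs0 : 0 <= A * Mp * \1_K y by rewrite mulr_ge0.
have [sx|nx] := pselect (strip x); last by rewrite ker_out// normr0.
have [Ky|nKy] := pselect (K y); last by rewrite ker_out_psi// normr0.
have [Ox xe] := sx.
rewrite kerE//; last exact: KOm.
have /andP[G0 G1] := GA Ox Ky xe.
have d0 := bdist_pow_gt0 Ox.
rewrite indicE mem_set// mulr1 mulrAC normrM; apply: ler_pM => //.
by rewrite ger0_norm ?divr_ge0// ?(ltW d0)// ler_pdivrMr.
Qed.

Lemma ker_section_integrable x : leb.-integrable setT (EFin \o (fun y => ker (x, y))).
Proof.
apply: (@bounded_integrable_on _ _ _ _ K (A * Mp)) => //; first exact: bounded_lty.
  exact: (measurableT_comp measurable_ker (measurable_pair1 x)).
exact: ker_le.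
Qed.

Lemma ker_integrable : (leb \x leb)%E.-integrable setT (EFin \o ker).
Proof.
apply: (@bounded_integrable_on _ _ _ _ (Om `*` K) (A * Mp)).
- exact: measurableX.
- rewrite [ltLHS]product_measure1E// lte_mul_pinfty ?bounded_lty//.
  by rewrite ge0_fin_numE// bounded_lty.
- exact: measurable_ker.
move=> [x y]; have [Ox|nOx] := pselect (Om x).
  apply: le_trans (ker_le x y) _; rewrite !indicE.
  by rewrite (_ : ((x, y) \in _) = (y \in K))// in_setX mem_set.
by rewrite ker_out ?normr0 ?mulr_ge0// => -[].
Qed.

Definition quot (x : T) : R := (\int[leb]_y ker (x, y))%R.

Lemma quotE x : (quot x)%:E = (\int[leb]_y (ker (x, y))%:E)%E.
Proof.
rewrite /quot /Rintegral fineK//; apply: integrable_fin_num => //.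
exact: ker_section_integrable.
Qed.

Lemma measurable_quot : measurable_fun setT quot.
Proof.
apply/measurable_EFinP; rewrite (_ : EFin \o quot = fubini_F leb (EFin \o ker)).
  exact: (measurable_fubini_F ker_integrable).
by apply/funext => x /=; rewrite quotE.
Qed.

Let MK := A * Mp * fine (leb K).

Lemma le_indic_integral (c : R) (f : T -> R) : 0 <= c -> measurable_fun setT f ->
  {ae leb, forall y, `|f y| <= c * \1_K y} ->
  (\int[leb]_y `|(f y)%:E| <= (c * fine (leb K))%:E)%E.
Proof.
move=> c0 mf fc.
rewrite EFinM [X in (_ * X)%E]fineK; last by rewrite ge0_fin_numE//; exact: bounded_lty.
rewrite -integral_cst_indic//; apply: ae_ge0_le_integral => //.
- by apply/measurable_EFinP; exact: measurableT_comp.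
- by move=> y _; rewrite -EFinM lee_fin mulr_ge0.
- by apply/measurable_EFinP; apply: measurable_funM.
- by apply: filterS fc => y fy _; rewrite -EFinM lee_fin.
Qed.

Lemma indic_section_integral (c : R) (f : T -> R) : 0 <= c ->
  leb.-integrable setT (EFin \o f) -> {ae leb, forall y, `|f y| <= c * \1_K y} ->
  `|\int[leb]_y f y| <= c * fine (leb K).
Proof.
move=> c0 intf fc; apply: le_trans (le_normr_Rintegral measurableT intf) _.
have mf : measurable_fun setT f by apply/measurable_EFinP; case/integrableP: intf.
rewrite -lee_fin; apply: le_trans (le_indic_integral c0 mf fc).
rewrite [leLHS]fineK//.
by apply: integrable_fin_num => //; have := integrable_norm intf.
Qed.

Lemma quot_le x : `|quot x| <= MK.
Proof.
apply: indic_section_integral => //; first exact: ker_section_integrable.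
by apply: aeW => y; exact: ker_le.
Qed.

Lemma quot_normal x : strip x -> quot x = normal_quotient Om gamma (green_operator Om G psi) x.
Proof.
move=> sx; have [Ox _] := sx; have d0 := bdist_pow_gt0 Ox.
rewrite /normal_quotient /green_operator.
apply: (canRL (mulfK _)); first by rewrite gt_eqF.
rewrite -RintegralZr//; last exact: ker_section_integrable.
rewrite [RHS]Rintegral_mkcond; apply: eq_Rintegral => y _; rewrite /patch.
have [Oy|nOy] := pselect (Om y); first by rewrite mem_set// kerE// divfK// gt_eqF.
by rewrite memNset// ker_out_psi ?mul0r// => /KOm.
Qed.

Definition Dker (p : T * T) : R :=
  ((fun p : T * T => D p.1 p.2) \_ (boundary Om `*` Om)) p * psi p.2.

Lemma measurable_Dker : measurable_fun setT Dker.
Proof.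
apply: measurable_funM.
  by apply/measurable_restrict => //; [exact: measurableX|rewrite setTI; case: hD].
exact: (measurableT_comp mpsi measurable_snd).
Qed.

Lemma DkerE z y : boundary Om z -> Om y -> Dker (z, y) = D z y * psi y.
Proof. by move=> bz Oy; rewrite /Dker /= /patch mem_set. Qed.

Lemma Dker_out z y : ~ boundary Om z -> Dker (z, y) = 0.
Proof. by move=> nz; rewrite /Dker /patch memNset ?mul0r// => -[]. Qed.

Lemma Dker_out_psi z y : ~ K y -> Dker (z, y) = 0.
Proof. by move=> nz; rewrite /Dker /= psi0// mulr0. Qed.

Lemma strip_near z (x_ : nat -> T) : boundary Om z ->
  (forall j, Om (x_ j)) -> x_ j @[j --> \oo] --> z -> \forall j \near \oo, strip (x_ j).
Proof.
move=> bz Ox xz.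
have : bdist Om (x_ j) @[j --> \oo] --> bdist Om z.
  by apply: continuous_cvg => //; exact: edist_continuous.
have -> : bdist Om z = 0.
  apply/eqP; rewrite eq_le edist_ge0 andbT.
  by rewrite (le_trans (edist_le z bz))// subrr enorm0.
move=> /cvgrPdist_le/(_ e e0); apply: filterS => j; rewrite sub0r normrN ger0_norm//.
exact: edist_ge0.
Qed.

Lemma ker_cvg z (x_ : nat -> T) : boundary Om z ->
  (forall j, Om (x_ j)) -> x_ j @[j --> \oo] --> z ->
  {ae leb, forall y, ker (x_ j, y) @[j --> \oo] --> Dker (z, y)}.
Proof.
move=> bz Ox xz; have := hD.2 z bz x_ Ox xz; apply: filterS => y H.
have [Ky|nKy] := pselect (K y); last first.
  rewrite Dker_out_psi//; apply: cvg_near_cst; apply: nearW => j.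
  by rewrite ker_out_psi.
have Oy := KOm Ky; rewrite DkerE//.
have H' : G (x_ j) y / bdist Om (x_ j) `^ gamma * psi y @[j --> \oo] --> D z y * psi y.
  by apply: cvgM; [exact: H|exact: cvg_cst].
apply: cvg_trans H'; apply: near_eq_cvg; apply: filterS (strip_near bz Ox xz) => j sj.
by rewrite kerE// mulrAC.
Qed.

(** The bound is inherited from [ker] along some sequence of Om converging to z, outside a null set
    of y that depends on z. *)
Lemma Dker_le z : {ae leb, forall y, `|Dker (z, y)| <= A * Mp * \1_K y}.
Proof.
have [bz|nz] := pselect (boundary Om z); last first.
  by apply: aeW => y; rewrite Dker_out// normr0 mulr_ge0.
have [x_ Ox xz] := closure_seq bz.1.
apply: filterS (ker_cvg bz Ox xz) => y H.
apply: (@closed_cvg nat R \oo _ (fun j => `|ker (x_ j, y)|)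
  (fun t => t <= A * Mp * \1_K y) _ _ _ (cvg_norm H)); first exact: closed_le.
by apply: nearW => j; exact: ker_le.
Qed.

Lemma Dker_section_integrable z : leb.-integrable setT (EFin \o (fun y => Dker (z, y))).
Proof.
have : leb.-integrable setT (EFin \o (fun y => A * Mp * \1_K y)).
  apply: (@bounded_integrable_on _ _ _ _ K (A * Mp)) => //.
  - exact: bounded_lty.
  - exact: measurable_funM.
  - by move=> y; rewrite ger0_norm// mulr_ge0.
move=> intK; apply/integrableP; split.
  apply/measurable_EFinP.
  exact: (measurableT_comp measurable_Dker (measurable_pair1 z)).
have /integrableP[_] := intK; apply: le_lt_trans.
apply: ae_ge0_le_integral => //.
- apply/measurable_EFinP; apply: measurableT_comp => //.
  exact: (measurableT_comp measurable_Dker (measurable_pair1 z)).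
- by apply/measurable_EFinP; apply: measurableT_comp => //; exact: measurable_funM.
- by apply: filterS (Dker_le z) => y Hy _; rewrite /= lee_fin (le_trans Hy)// ler_norm.
Qed.

Definition bquot (z : T) : R := (\int[leb]_y Dker (z, y))%R.

Lemma bquotE z : (bquot z)%:E = (\int[leb]_y (Dker (z, y))%:E)%E.
Proof.
rewrite /bquot /Rintegral fineK//; apply: integrable_fin_num => //.
exact: Dker_section_integrable.
Qed.

Lemma bquot_le z : `|bquot z| <= MK.
Proof.
by apply: indic_section_integral; [|exact: Dker_section_integrable|exact: Dker_le].
Qed.

Lemma bquot_out z : ~ boundary Om z -> bquot z = 0.
Proof.
move=> nz; rewrite /bquot (@eq_Rintegral _ _ _ leb setT (fun=> 0)) => [|y _]; last exact: Dker_out.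
by rewrite /Rintegral integral0.
Qed.

Lemma quot_cvg z : boundary Om z -> quot x @[x --> within Om (nbhs z)] --> bquot z.
Proof.
move=> bz; apply: cvg_within_seq => x_ Ox xz.
have [|||||_ _] := @dominated_convergence _ _ _ leb setT measurableT
  (fun j y => (ker (x_ j, y))%:E) (fun y => (Dker (z, y))%:E) (fun y => (A * Mp * \1_K y)%:E).
- move=> j; apply/measurable_EFinP.
  exact: (measurableT_comp measurable_ker (measurable_pair1 (x_ j))).
- apply/measurable_EFinP.
  exact: (measurableT_comp measurable_Dker (measurable_pair1 z)).
- apply: filterS (ker_cvg bz Ox xz) => y H _; apply: cvg_EFin => //.
  exact: nearW.
- apply: (@bounded_integrable_on _ _ _ _ K (A * Mp)) => //.
  + exact: bounded_lty.
  + exact: measurable_funM.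
  + by move=> y; rewrite ger0_norm// mulr_ge0.
- by apply: aeW => y j _; rewrite lee_fin; exact: ker_le.
rewrite -bquotE => H; exact: (fine_cvg H).
Qed.

Lemma quot_has_normal_derivative z : boundary Om z ->
  has_normal_derivative Om gamma (green_operator Om G psi) z /\
  normal_derivative Om gamma (green_operator Om G psi) z = bquot z.
Proof.
move=> bz.
have PF : ProperFilter (within Om (nbhs z)) by apply: within_nbhs_proper; case: bz.
have H : normal_quotient Om gamma (green_operator Om G psi) x @[x --> within Om (nbhs z)] --> bquot z.
  apply: cvg_trans (quot_cvg bz); apply: near_eq_cvg; rewrite near_withinE.
  have : \forall x \near z, bdist Om x < e.
    have /cvgrPdist_lt/(_ e e0) : bdist Om x @[x --> z] --> bdist Om z by exact: edist_continuous.
    have -> : bdist Om z = 0.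
      apply/eqP; rewrite eq_le edist_ge0 andbT.
      by rewrite (le_trans (edist_le z bz))// subrr enorm0.
    by apply: filterS => x; rewrite sub0r normrN ger0_norm//; exact: edist_ge0.
  by apply: filterS => x xe Ox; apply: quot_normal; split => //; exact: ltW.
split; first by apply/cvg_ex; exists (bquot z).
exact: (cvg_lim _ H).
Qed.

Hypothesis hOm : bounded_C11_domain Om.
Variable sigma : {sigma_finite_measure set T -> \bar R}.
Hypothesis hsigma : surface_measure Om sigma.

Let slty : (sigma setT < +oo)%E. Proof. exact: surface_lty hOm hsigma. Qed.

(** The exceptional sets in y vary with z, so integrability on the product is checked by integrating
    in y first: the inner integral is at most [MK], and [sigma] is finite. *)
Lemma Dker_integrable : (sigma \x leb)%E.-integrable setT (EFin \o Dker).
Proof.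
apply/integrable12ltyP; first by apply/measurable_EFinP; exact: measurable_Dker.
apply: (@le_lt_trans _ _ (\int[sigma]_z MK%:E)%E); last first.
  by rewrite integral_cst// lte_mul_pinfty// lee_fin mulr_ge0// fine_ge0.
apply: ge0_le_integral => //.
- by move=> z _; exact: integral_ge0.
- apply: (@measurable_fun_fubini_tonelli_F _ _ _ _ _ _ (fun p => `|(Dker p)%:E|%E)) => //.
  by apply/measurable_EFinP; apply: measurableT_comp => //; exact: measurable_Dker.
move=> z _; apply: le_indic_integral => //; last exact: Dker_le.
exact: (measurableT_comp measurable_Dker (measurable_pair1 z)).
Qed.

Lemma measurable_bquot : measurable_fun setT bquot.
Proof.
apply/measurable_EFinP; rewrite (_ : EFin \o bquot = fubini_F leb (EFin \o Dker)).
  exact: (measurable_fubini_F Dker_integrable).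
by apply/funext => x /=; rewrite bquotE.
Qed.

Lemma layer_quot_average :
  (j%:R%:E * \int[leb]_x (quot x * \1_(layer Om j) x)%:E)%E @[j --> \oo] -->
  (\int[sigma]_z (bquot z)%:E)%E.
Proof.
apply: (@layer_average _ _ Om sigma hOm hsigma b0 MK) => //.
- exact: measurable_quot.
- exact: measurable_bquot.
- exact: quot_le.
- exact: bquot_le.
- exact: bquot_out.
- exact: quot_cvg.
Qed.

Lemma bquot_integrable : sigma.-integrable setT (EFin \o bquot).
Proof.
apply: (bounded_surface_integrable hOm hsigma); first exact: measurable_bquot.
exact: bquot_le.
Qed.

(* The value is 0 where the integral diverges, which is a null set. *)
Definition ustar (y : T) : R := fine (\int[sigma]_(z in boundary Om) (D z y)%:E)%E.

Lemma measurable_ustar : measurable_fun Om ustar.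
Proof.
pose Dt p := (((fun p : T * T => D p.1 p.2) \_ (boundary Om `*` Om)) p)%:E.
have mDt : measurable_fun setT Dt.
  apply/measurable_EFinP; apply/measurable_restrict => //; first exact: measurableX.
  by rewrite setTI; case: hD.
(* Only [Dker], with its factor psi, is known to be integrable on the product, so the positive and
   negative parts of D are treated separately by Tonelli. *)
have mfub : measurable_fun setT (fun y => fine (\int[sigma]_z Dt (z, y))%E).
  apply: (measurableT_comp (fine_measurable measurableT)).
  under eq_fun do rewrite integralE.
  apply: emeasurable_funB.
    have := @measurable_fun_fubini_tonelli_G _ _ T T R sigma (Dt^\+)%E
      (measurable_funepos mDt) (funepos_ge0 Dt).
    by apply: eq_measurable_fun => y _; apply: eq_integral => z _; rewrite !funeposE.
  have := @measurable_fun_fubini_tonelli_G _ _ T T R sigma (Dt^\-)%E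
    (measurable_funeneg mDt) (funeneg_ge0 Dt).
  by apply: eq_measurable_fun => y _; apply: eq_integral => z _; rewrite !funenegE.
apply: eq_measurable_fun (measurable_funTS mfub) => y; rewrite inE => Oy.
congr fine; rewrite [RHS]integral_mkcond; apply: eq_integral => z _.
rewrite /Dt /patch /=; case: ifPn; rewrite ?(inE, notin_setE) /=.
  by case=> bz _; rewrite mem_set.
by move=> nz; rewrite memNset// => bz; apply: nz.
Qed.

(** By Fubini almost every section of [Dker] in z is integrable, and dividing by psi y, where it is
    nonzero, gives the same for D. Where psi y = 0, both sides of the equation are 0 whatever the
    value of [ustar]. *)
Lemma ustar_psi_fin : {ae leb, forall y,
  (psi y != 0 -> (\int[sigma]_(z in boundary Om) (D z y)%:E)%E \is a fin_num) /\
  (ustar y * psi y)%:E = (\int[sigma]_z (Dker (z, y))%:E)%E}.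
Proof.
apply: filterS (ae_integrable2 Dker_integrable) => y /= inty.
have [py|py] := eqVneq (psi y) 0.
  split => //; rewrite py mulr0 integral0_eq// => z _.
  by rewrite /Dker /= py mulr0.
have Oy : Om y by apply: KOm; apply: contrapT => /psi0/eqP; exact/negP.
have intD : sigma.-integrable (boundary Om) (fun z => (D z y)%:E).
  have : sigma.-integrable (boundary Om) (fun z => (psi y)^-1%:E * (Dker (z, y))%:E)%E.
    by apply: integrableZl => //; apply: integrableS inty.
  apply: eq_integrable => // z; rewrite inE => bz.
  by rewrite -EFinM DkerE// mulrCA mulVf// mulr1.
split => [_|]; first exact: integrable_fin_num.
rewrite EFinM fineK; last exact: integrable_fin_num.
rewrite -integralZr// [LHS]integral_mkcond; apply: eq_integral => z _; rewrite /patch.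
case: ifPn => [|/negP]; rewrite inE => bz; first by rewrite DkerE// EFinM.
by rewrite Dker_out.
Qed.

Lemma ustar_psi_integrable : leb.-integrable Om (fun y => (ustar y * psi y)%:E).
Proof.
have mup : measurable_fun Om (fun y => (ustar y * psi y)%:E).
  apply/measurable_EFinP; apply: measurable_funM; first exact: measurable_ustar.
  exact: measurable_funTS.
have intG := integrable_fubini_G Dker_integrable.
have /integrableP[mfG intGlt] := integrableS measurableT mOm (@subsetT _ _) intG.
apply/integrableP; split => //; apply: le_lt_trans intGlt.
rewrite le_eqVlt; apply/orP; left; apply/eqP; apply: ae_eq_integral => //.
- exact: measurableT_comp.
- exact: measurableT_comp.
- by apply: filterS ustar_psi_fin => y [_ ->].
Qed.

Lemma integral_ustar_psi :
  (\int[leb]_(x in Om) (ustar x * psi x)%:E = \int[sigma]_(z in boundary Om)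
    (normal_derivative Om gamma (green_operator Om G psi) z)%:E)%E.
Proof.
have mup : measurable_fun Om (fun y => (ustar y * psi y)%:E).
  by case/integrableP: ustar_psi_integrable.
have intG := integrable_fubini_G Dker_integrable.
have /integrableP[mfG intGlt] := integrableS measurableT mOm (@subsetT _ _) intG.
rewrite (ae_eq_integral (fubini_G sigma (EFin \o Dker)))//; last first.
  by apply: filterS ustar_psi_fin => y [_ ->].
transitivity (\int[leb]_y fubini_G sigma (EFin \o Dker) y)%E.
  rewrite integral_mkcond; apply: eq_integral => y _; rewrite /patch.
  case: ifPn => // /negP; rewrite inE => nOy; apply/esym/integral0_eq => z _ /=.
  by rewrite Dker_out_psi// => /KOm.
rewrite (integral21_prod_meas1 Dker_integrable) -(integral12_prod_meas1 Dker_integrable).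
rewrite [RHS]integral_mkcond; apply: eq_integral => z _; rewrite /patch.
case: ifPn => [|/negP]; rewrite inE => bz.
  by rewrite (quot_has_normal_derivative bz).2 bquotE.
by apply: integral0_eq => y _ /=; rewrite Dker_out.
Qed.

Lemma integral_normal_derivative :
  (\int[sigma]_(z in boundary Om)
     (normal_derivative Om gamma (green_operator Om G psi) z)%:E =
   \int[sigma]_z (bquot z)%:E)%E.
Proof.
rewrite integral_mkcond; apply: eq_integral => z _; rewrite /patch.
case: ifPn => [|/negP]; rewrite inE => bz; first by rewrite (quot_has_normal_derivative bz).2.
by rewrite bquot_out.
Qed.

Lemma integral_psi_compact (v : T -> R) :
  (\int[leb]_(x in K) (v x * psi x)%:E = \int[leb]_(x in Om) (v x * psi x)%:E)%E.
Proof.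
rewrite integral_mkcond [RHS]integral_mkcond; apply: eq_integral => x _.
rewrite /patch; have [Kx|nKx] := pselect (K x).
  by rewrite !mem_set//; exact: KOm.
by rewrite [in LHS]memNset// psi0// mulr0; case: ifP.
Qed.

Hypothesis Gsym : forall x y, Om x -> Om y -> G x y = G y x.
Local Notation u_ j := (green_operator Om G (layer_fun Om sigma gamma j)).

Let mlay j : measurable (layer Om j). Proof. exact: layer_measurable. Qed.
Let laylty j : (leb (layer Om j) < +oo)%E. Proof. exact: layer_lty. Qed.

Lemma layer_strip : \forall j \near \oo, layer Om j `<=` strip.
Proof.
have e2 : 0 < e / 2 by rewrite divr_gt0.
apply: filterS (natSinv_near e2) => j /andP[_ je] x [Ox /andP[_ xj]]; split => //=.
by apply: ltW; apply: lt_le_trans xj _; lra.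
Qed.

Definition layer_ker j (p : T * T) : R := \1_(layer Om j) p.1 * ker p.

Lemma layer_kerE j x y : layer_ker j (y, x) = \1_(layer Om j) y * ker (y, x).
Proof. by []. Qed.

Lemma measurable_layer_ker j : measurable_fun setT (layer_ker j).
Proof.
apply: measurable_funM; last exact: measurable_ker.
by apply: (measurableT_comp _ measurable_fst); exact: measurable_indic.
Qed.

Lemma layer_ker_le j x y : `|layer_ker j (y, x)| <= A * Mp * \1_(layer Om j) y.
Proof.
rewrite /layer_ker /= normrM indicE; case: (_ \in _); last by rewrite normr0 mul0r mulr0.
rewrite normr1 mul1r mulr1; apply: le_trans (ker_le y x) _.
by rewrite -[leRHS]mulr1 ler_wpM2l// indicE; case: (_ \in _).
Qed.

Lemma layer_ker_integrable j : (leb \x leb)%E.-integrable setT (EFin \o layer_ker j).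
Proof.
apply: le_integrable ker_integrable => //.
  by apply/measurable_EFinP; exact: measurable_layer_ker.
move=> [y x] _; rewrite lee_fin /layer_ker /= normrM ger0_norm// indicE.
by case: (_ \in _); rewrite ?mul1r// mul0r.
Qed.

Lemma layer_ker_section_integrable j x :
  leb.-integrable setT (EFin \o (fun y => layer_ker j (y, x))).
Proof.
apply: (@bounded_integrable_on _ _ _ _ (layer Om j) (A * Mp)).
- exact: mlay.
- exact: laylty.
- exact: (measurableT_comp (measurable_layer_ker j) (measurable_pair2 x)).
- by move=> y; exact: layer_ker_le.
Qed.

Definition layer_const j : R := fine (sigma (boundary Om)) / fine (leb (layer Om j)).

(** The weight delta^(-gamma) of the layer function is exactly the denominator in [ker], and the
    symmetry of G lets the layer variable come first. *)
Lemma green_layer_psi j x : layer Om j `<=` strip ->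
  u_ j x * psi x = layer_const j * (\int[leb]_y layer_ker j (y, x))%R.
Proof.
move=> js; have intx := layer_ker_section_integrable j x.
(* Symmetry is available inside Om, and psi x != 0 places x there; otherwise both sides vanish. *)
have [p0|p0] := eqVneq (psi x) 0.
  rewrite p0 mulr0; apply/esym/eqP; rewrite mulf_eq0; apply/orP; right; apply/eqP.
  rewrite /Rintegral integral0_eq// => y _.
  by rewrite /layer_ker /ker p0 mulr0 !mul0r mulr0.
have Ox : Om x by apply: KOm; apply: contrapT => /psi0/eqP; exact/negP.
apply: (canLR (divfK p0)); rewrite mulrAC.
rewrite -RintegralZl// /green_operator [LHS]Rintegral_mkcond.
apply: eq_Rintegral => y _; rewrite /patch layer_kerE.
have [Ly|nLy] := pselect (layer Om j y); last first.
  rewrite [in RHS]indicE (memNset nLy) mul0r mulr0.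
  by case: ifP => // _; rewrite /layer_fun indicE (memNset nLy) mulr0 mul0r mulr0.
have sy := js _ Ly; have [Oy _] := sy.
rewrite mem_set// kerE// /layer_fun /layer_const indicE mem_set// mulr1 mul1r.
rewrite (Gsym Ox Oy).
have b1 := bdist_pow_gt0 Oy.
rewrite invfM; set S := fine _; set L := (fine _)^-1; set B := (_ `^ _)^-1.
by rewrite -[in RHS]mulrA [in RHS]mulrC; field.
Qed.

Lemma green_layer_psi_integrable j : layer Om j `<=` strip ->
  leb.-integrable K (fun x => (u_ j x * psi x)%:E).
Proof.
move=> js; have intG := integrable_fubini_G (layer_ker_integrable j).
have : leb.-integrable K (fun x =>
    (layer_const j)%:E * fubini_G leb (EFin \o layer_ker j) x)%E.
  by apply: integrableZl => //; exact: integrableS intG.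
apply: eq_integrable => // x _.
rewrite green_layer_psi// [RHS]EFinM; apply: congr1; apply/esym.
by rewrite /Rintegral fineK//; exact: integrable_fin_num (layer_ker_section_integrable j x).
Qed.

Lemma integral_green_layer j : layer Om j `<=` strip ->
  (\int[leb]_(x in K) (u_ j x * psi x)%:E =
   (layer_const j)%:E * \int[leb]_y (quot y * \1_(layer Om j) y)%:E)%E.
Proof.
move=> js; have intL := layer_ker_integrable j; have intG := integrable_fubini_G intL.
transitivity (\int[leb]_x ((layer_const j)%:E * fubini_G leb (EFin \o layer_ker j) x))%E.
  rewrite integral_mkcond; apply: eq_integral => x _; rewrite /patch.
  have intx := integrable_fin_num measurableT (layer_ker_section_integrable j x).
  have [Kx|nKx] := pselect (K x).
    rewrite mem_set// green_layer_psi// EFinM; congr (_ * _)%E.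
    by rewrite /Rintegral fineK.
  rewrite memNset// /fubini_G integral0_eq ?mule0// => y _.
  by rewrite /comp /layer_ker ker_out_psi// mulr0.
rewrite integralZl//; congr (_ * _)%E.
rewrite (integral21_prod_meas1 intL) -(integral12_prod_meas1 intL).
apply: eq_integral => y _; rewrite /fubini_F mulrC EFinM quotE -integralZl//.
exact: ker_section_integrable.
Qed.

Lemma surface_boundary : sigma (boundary Om) = sigma setT.
Proof.
rewrite -(setUv (boundary Om)) measureU ?setICr//; last exact: measurableC.
by rewrite [X in (_ + X)%E](_ : _ = 0%E) ?adde0//; case: hsigma.
Qed.

(** The case h = 1 of [layer_average]; boundary values have to vanish off the boundary, hence the
    indicator. *)
Lemma layer_measure_cvg :
  (j%:R%:E * leb (layer Om j))%E @[j --> \oo] --> sigma (boundary Om).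
Proof.
have := @layer_average _ _ Om sigma hOm hsigma b0 1 (cst 1) (\1_(boundary Om)).
rewrite integral_indic// setIT => H.
have {}H : (j%:R%:E * \int[leb]_x (1 * \1_(layer Om j) x)%:E)%E @[j --> \oo] --> sigma (boundary Om).
  apply: H => //.
  - by move=> x; rewrite normr1.
  - by move=> x; rewrite indicE; case: (_ \in _); rewrite ?normr1 ?normr0.
  - by move=> z nz; rewrite indicE memNset.
  - by move=> z bz; rewrite indicE mem_set//; exact: cvg_cst.
apply: cvg_trans H; apply: near_eq_cvg; apply: nearW => j; congr (_ * _)%E.
under eq_integral do rewrite mul1r.
by rewrite integral_indic// setIT.
Qed.

Lemma green_layer_cvg :
  (\int[leb]_(x in K) (u_ j x * psi x)%:E)%E @[j --> \oo] -->
  (\int[leb]_(x in K) (ustar x * psi x)%:E)%E.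
Proof.
rewrite integral_psi_compact integral_ustar_psi integral_normal_derivative.
set I := fun j => (\int[leb]_y (quot y * \1_(layer Om j) y)%:E)%E.
suff H : ((layer_const j)%:E * I j)%E @[j --> \oo] --> (\int[sigma]_z (bquot z)%:E)%E.
  apply: cvg_trans H; apply: near_eq_cvg; apply: filterS layer_strip => j js.
  by rewrite integral_green_layer.
have IB := layer_quot_average; have LS := layer_measure_cvg.
rewrite surface_boundary in LS.
(* The ratio below is divided by the limit of j |A_j|; when that limit is 0, both sides of the claim
   are 0. *)
have [S0|S0] := eqVneq (sigma setT) 0%E.
  rewrite (_ : (\int[sigma]_z _)%E = 0%E); last first.
    by apply: null_set_integral => //; apply/measurable_EFinP; exact: measurable_bquot.
  rewrite (_ : (fun _ => _) = cst 0%E); first exact: cvg_cst.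
  by apply/funext => j; rewrite /layer_const surface_boundary S0 mul0r mul0e.
have Sfin : sigma setT \is a fin_num by rewrite ge0_fin_numE.
have Bfin := integrable_fin_num measurableT bquot_integrable.
have Ifin j : I j \is a fin_num.
  apply: integrable_fin_num => //.
  exact: (bounded_layer_integrable hOm j measurable_quot quot_le).
have Lfin j : leb (layer Om j) \is a fin_num by rewrite ge0_fin_numE.
set S := fine (sigma setT).
have Sn0 : S != 0 by rewrite /S fine_eq0.
have c1 : (j%:R * fine (I j)) @[j --> \oo] --> fine (\int[sigma]_z (bquot z)%:E)%E.
  move: IB; rewrite -[X in _ --> X -> _]fineK// => /fine_cvg; apply: cvg_trans.
  by apply: near_eq_cvg; apply: nearW => j; apply: fineM => //; exact: Ifin.
have c2 : (j%:R * fine (leb (layer Om j))) @[j --> \oo] --> S.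
  move: LS; rewrite -[X in _ --> X -> _]fineK// => /fine_cvg; apply: cvg_trans.
  by apply: near_eq_cvg; apply: nearW => j; apply: fineM => //; exact: Lfin.
rewrite -[X in _ --> X]fineK//; apply: cvg_EFin.
  by apply: nearW => j; rewrite fin_numM.
(* The factors j cancel in this ratio, and the factor [S] is the total mass in [layer_const]. *)
have c3 : (j%:R * fine (I j)) / (j%:R * fine (leb (layer Om j))) * S @[j --> \oo] -->
    fine (\int[sigma]_z (bquot z)%:E)%E / S * S.
  by apply: cvgM; [apply: cvgM => //; exact: cvgV|exact: cvg_cst].
rewrite divfK// in c3; apply: cvg_trans c3; apply: near_eq_cvg; exists 1%N => // j j1.
rewrite /comp fineM// [fine _%:E]/(layer_const j) /layer_const surface_boundary -/S.
have jn0 : j%:R != 0 :> R by rewrite pnatr_eq0 -lt0n.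
by rewrite invfM; set L := (fine _)^-1; field.
Qed.

End potential.

(** * The weak limit *)

Section weak_limit.
Context {R : realType} {m : nat}.
Local Notation T := 'rV[R]_m.+1.
Local Notation leb := (@lebesgue_rV R m.+1).
Variables (Om : set T) (s gamma : R) (G D : T -> T -> R).
Variable sigma : {sigma_finite_measure set T -> \bar R}.
Hypotheses (hOm : bounded_C11_domain Om) (hsigma : surface_measure Om sigma).
Hypotheses (hG : green_kernel Om s gamma G) (hD : kernel_normal_derivative Om gamma G D).
Local Notation u := (ustar Om D sigma).
Local Notation u_ j := (green_operator Om G (layer_fun Om sigma gamma j)).

Let oOm : open Om. Proof. by case: hOm. Qed.
Let bOm : bounded_set Om. Proof. by case: hOm. Qed.
Let b0 : boundary Om !=set0. Proof. by apply: boundary_neq0 => //; case: hOm. Qed.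
Let mOm : measurable Om. Proof. exact: open_measurable_rV. Qed.

(** The single source of the final claims: psi = [\1_K] gives integrability and finiteness, a
    truncation of g the weak convergence, and a test function cut off to K the duality. *)
Lemma ustar_test K (psi : T -> R) (Mp : R) : compact K -> K `<=` Om ->
  measurable_fun setT psi -> (forall y, `|psi y| <= Mp) -> (forall y, ~ K y -> psi y = 0) ->
  [/\ (forall z, boundary Om z ->
         has_normal_derivative Om gamma (green_operator Om G psi) z) /\
      (\int[leb]_(x in Om) (u x * psi x)%:E = \int[sigma]_(z in boundary Om)
         (normal_derivative Om gamma (green_operator Om G psi) z)%:E)%E,
    leb.-integrable Om (fun x => (u x * psi x)%:E),
    \forall j \near \oo, leb.-integrable K (fun x => (u_ j x * psi x)%:E),
    (\int[leb]_(x in K) (u_ j x * psi x)%:E)%E @[j --> \oo] -->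
      (\int[leb]_(x in K) (u x * psi x)%:E)%E &
    {ae leb, forall x, psi x != 0 ->
      (\int[sigma]_(z in boundary Om) (D z x)%:E)%E \is a fin_num}].
Proof.
move=> cK KOm mpsi psiM psi0; have [_ [mG Gsym _]] := hG.
have [e [A [e0 A0 _ GA]]] := green_bound oOm bOm b0 hG cK KOm.
split.
- split=> [z bz|].
    exact: (quot_has_normal_derivative oOm bOm b0 mG hD cK KOm e0 A0 GA mpsi psiM psi0 bz).1.
  exact: (integral_ustar_psi oOm bOm b0 mG hD cK KOm e0 A0 GA mpsi psiM psi0).
- exact: (ustar_psi_integrable oOm bOm b0 hD cK KOm e0 A0 GA mpsi psiM psi0).
- apply: filterS (layer_strip Om e0) => j.
  exact: (green_layer_psi_integrable oOm bOm b0 mG cK KOm A0 GA mpsi psiM psi0).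
- exact: (green_layer_cvg oOm bOm b0 mG hD cK KOm e0 A0 GA mpsi psiM psi0).
- have := ustar_psi_fin oOm bOm b0 hD cK KOm e0 A0 GA mpsi psiM psi0 hOm hsigma.
  by apply: filterS => x [].
Qed.

Let test_indic K : compact K -> K `<=` Om ->
  [/\ leb.-integrable Om (fun x => (u x * \1_K x)%:E),
    \forall j \near \oo, leb.-integrable K (fun x => (u_ j x * \1_K x)%:E) &
    {ae leb, forall x, K x ->
      (\int[sigma]_(z in boundary Om) (D z x)%:E)%E \is a fin_num}].
Proof.
move=> cK KOm; have mK : measurable K by exact: compact_measurable_rV.
have [|||_ ? ? _ H] := @ustar_test K (\1_K) 1 cK KOm.
- exact: measurable_indic.
- by move=> y; rewrite indicE; case: (_ \in _); rewrite ?normr1 ?normr0.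
- by move=> y nK; rewrite indicE memNset.
by split => //; apply: filterS H => x Hx Kx; apply: Hx; rewrite indicE mem_set// oner_eq0.
Qed.

Let L1_indic K (v : T -> R) : measurable K ->
  leb.-integrable K (fun x => (v x * \1_K x)%:E) -> L1 K v.
Proof.
move=> mK; apply: eq_integrable => // x xK.
by rewrite indicE xK mulr1.
Qed.

Lemma ustar_L1loc : L1loc Om u.
Proof.
move=> K cK KOm; have mK : measurable K by exact: compact_measurable_rV.
by apply: L1_indic => //; case: (test_indic cK KOm) => + _ _; exact: integrableS.
Qed.

Lemma ustar_weak_cvg K : compact K -> K `<=` Om -> weak_L1_cvg K (fun j => u_ j) u.
Proof.
move=> cK KOm; have mK : measurable K by exact: compact_measurable_rV.
have L1u : L1 K u by exact: ustar_L1loc.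
have L1uj : \forall j \near \oo, L1 K (u_ j).
  by case: (test_indic cK KOm) => _ + _; apply: filterS => j; exact: L1_indic.
split => // g [mg [M gM]].
(* [g] is bounded almost everywhere only, and measurable on K only. Cutting it off to [E] changes no
   integral over K and gives a bounded test function; its bound is |M| because M may be negative. *)
pose E := K `&` g @^-1` `[- M, M]%classic.
have mE : measurable E by apply: mg => //; exact: measurable_itv.
have [|||_ _ _ H _] := @ustar_test K (g \_ E) `|M| cK KOm.
- apply/measurable_restrict => //; rewrite setTI.
  by apply: measurable_funS mg => // x [].
- move=> y; rewrite /patch; case: ifPn; last by rewrite normr0.
  rewrite inE => -[_]; rewrite /= in_itv /= -ler_norml => /le_trans; apply.
  exact: ler_norm.
- by move=> y nK; rewrite /patch memNset// => -[].
have gE (v : T -> R) : L1 K v ->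
    (\int[leb]_(x in K) (v x * (g \_ E) x)%:E = \int[leb]_(x in K) (v x * g x)%:E)%E.
  case/integrableP => /measurable_EFinP mv _; apply: ae_eq_integral => //.
  - apply/measurable_EFinP; apply: measurable_funM => //; apply: measurable_funTS.
    apply/measurable_restrict => //; rewrite setTI.
    by apply: measurable_funS mg => // x [].
  - by apply/measurable_EFinP; exact: measurable_funM.
  - apply: filterS gM => x gx Kx; rewrite /patch mem_set//; split => //=.
    by rewrite in_itv /= -ler_norml gx.
rewrite -gE//; apply: cvg_trans H; apply: near_eq_cvg.
by apply: filterS L1uj => j /gE.
Qed.

Lemma ustar_dual psi : Linfc Om psi ->
  (forall z, boundary Om z -> has_normal_derivative Om gamma (green_operator Om G psi) z) /\
  (\int[leb]_(x in Om) (u x * psi x)%:E = \int[sigma]_(z in boundary Om)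
    (normal_derivative Om gamma (green_operator Om G psi) z)%:E)%E.
Proof.
move=> [mpsi [M psiM] [K [cK KOm] psi0]].
have mK : measurable K by exact: compact_measurable_rV.
have psiE x : Om x -> (psi \_ K) x = psi x.
  move=> Ox; rewrite /patch; case: ifPn => // /negP; rewrite inE => nK.
  by rewrite psi0.
have -> : green_operator Om G psi = green_operator Om G (psi \_ K).
  apply/funext => x; apply: eq_Rintegral => y; rewrite inE => Oy.
  by rewrite psiE.
have [|||H _ _ _ _] := @ustar_test K (psi \_ K) `|M| cK KOm.
- apply/measurable_restrict => //; rewrite setTI; exact: measurable_funS mpsi.
- move=> y; rewrite /patch; case: ifPn; last by rewrite normr0.
  by rewrite inE => /KOm/psiM/le_trans; apply; exact: ler_norm.
- by move=> y nK; rewrite /patch memNset.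
rewrite -H.2; split; first exact: H.1.
by apply: eq_integral => x; rewrite inE => Ox; rewrite psiE.
Qed.

(** Taking the closure gives compactness; its points outside Om are boundary points, which the bound
    on delta excludes. *)
Lemma compact_exhaustion (k : nat) :
  let K := closure Om `&` [set x | k.+1%:R^-1 <= bdist Om x] in compact K /\ K `<=` Om.
Proof.
move=> K; split.
  apply: compact_closedI.
    by apply: bounded_closed_compact; [exact: closure_bounded|exact: closed_closure].
  apply: (@closed_comp _ _ (bdist Om) [set t | k.+1%:R^-1 <= t]); last exact: closed_ge.
  by move=> x _; exact: edist_continuous.
move=> x [clx /= kx]; apply: contrapT => nOx.
have bx : boundary Om x by split => // /interior_subset.
have : bdist Om x <= 0 by rewrite (le_trans (edist_le x bx))// subrr enorm0.
by apply/negP; rewrite -ltNge (lt_le_trans _ kx)// invr_gt0 ltr0n.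
Qed.

(** Countably many compact sets exhaust Om, and on each the integral is finite almost everywhere;
    where it is finite, [fine] loses nothing. *)
Lemma ustarE : {ae leb, forall x, Om x ->
  ((u x)%:E = \int[sigma]_(z in boundary Om) (D z x)%:E)%E}.
Proof.
have : {ae leb, forall x, forall k : nat,
    (closure Om `&` [set x | k.+1%:R^-1 <= bdist Om x]) x ->
    (\int[sigma]_(z in boundary Om) (D z x)%:E)%E \is a fin_num}.
  apply: ae_foralln => k; have [cK KOm] := compact_exhaustion k.
  by case: (test_indic cK KOm).
apply: filterS => x Hx Ox; rewrite /ustar fineK//.
have d0 := bdist_gt0 b0 oOm Ox.
have [k _ /(_ k (leqnn k)) kx] := natSinv_near d0.
have [k0|k0] := posnP k; first by move: kx; rewrite k0 invr0 ltxx.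
move: kx; rewrite -(prednK k0) => /andP[_ kx].
by apply: (Hx k.-1); split => /=; [exact: subset_closure|exact: ltW].
Qed.

End weak_limit.

(** A nonempty layer is open and bounded, so its measure is positive and finite, and the
    normalization divides by a genuine positive number. *)
Lemma layer_fun_mass (R : realType) m (Om : set 'rV[R]_m.+1)
    (sigma : {measure set 'rV[R]_m.+1 -> \bar R}) (gamma : R) j :
  bounded_C11_domain Om -> surface_measure Om sigma -> layer Om j !=set0 ->
  (\int[lebesgue_rV m.+1]_(x in Om)
     `|layer_fun Om sigma gamma j x * bdist Om x `^ gamma|%:E = sigma (boundary Om))%E.
Proof.
move=> hOm hsigma lj; have [ne oOm _ bOm _] := hOm.
have b0 := boundary_neq0 ne bOm; have mOm := open_measurable_rV oOm.
have ml := layer_measurable j oOm.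
have Lpos := lebesgue_rV_open_gt0 (layer_open oOm) lj.
have Lfin : lebesgue_rV m.+1 (layer Om j) \is a fin_num.
  by rewrite ge0_fin_numE// (layer_lty hOm).
have Sfin : sigma (boundary Om) \is a fin_num.
  rewrite ge0_fin_numE//; apply: le_lt_trans (surface_lty hOm hsigma).
  by apply: le_measure; rewrite ?inE//; apply: closed_measurable_rV; exact: boundary_closed.
set S := fine (sigma (boundary Om)); set L := fine (lebesgue_rV m.+1 (layer Om j)).
have L0 : 0 < L by rewrite fine_gt0// Lpos ltey_eq Lfin.
have S0 : 0 <= S by rewrite fine_ge0.
transitivity (\int[lebesgue_rV m.+1]_(x in Om) ((S / L)%:E * (\1_(layer Om j) x)%:E))%E.
  apply: eq_integral => x; rewrite inE => Ox; rewrite -EFinM; congr EFin.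
  have d0 : 0 < bdist Om x `^ gamma by apply: powR_gt0; exact: bdist_gt0.
  have -> : layer_fun Om sigma gamma j x * bdist Om x `^ gamma =
      S / L * \1_(layer Om j) x.
    by rewrite /layer_fun -/S -/L; field; rewrite !gt_eqF.
  by rewrite ger0_norm// mulr_ge0// divr_ge0// ltW.
rewrite ge0_integralZl//; first last.
- by rewrite lee_fin divr_ge0// ltW.
- by apply/measurable_EFinP; apply: measurable_funTS.
rewrite integral_indic// setIidl; last by move=> x [].
by rewrite -[X in (_ * X)%E]fineK// -EFinM divfK ?gt_eqF// fineK.
Qed.

Theorem theorem4p1 (R : realType) (m : nat) (Om : set 'rV[R]_m.+1)
    (sigma : {measure set 'rV[R]_m.+1 -> \bar R}) (s gamma : R)
    (G D : 'rV[R]_m.+1 -> 'rV[R]_m.+1 -> R)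
    (hOm : bounded_C11_domain Om)
    (hsigma : surface_measure Om sigma)
    (hG : green_kernel Om s gamma G)
    (hD : kernel_normal_derivative Om gamma G D) :
  (forall j : nat, layer Om j !=set0 ->
     (\int[lebesgue_rV m.+1]_(x in Om)
        `|layer_fun Om sigma gamma j x * bdist Om x `^ gamma|%:E =
      sigma (boundary Om))%E) /\
  exists u : 'rV[R]_m.+1 -> R,
    [/\ L1loc Om u,
      forall K, compact K -> K `<=` Om ->
        weak_L1_cvg K
          (fun j => green_operator Om G (layer_fun Om sigma gamma j)) u,
      forall psi, Linfc Om psi ->
        (forall z, boundary Om z ->
           has_normal_derivative Om gamma (green_operator Om G psi) z) /\
        (\int[lebesgue_rV m.+1]_(x in Om) (u x * psi x)%:E =
         \int[sigma]_(z in boundary Om)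
           (normal_derivative Om gamma (green_operator Om G psi) z)%:E)%E &
      {ae lebesgue_rV m.+1, forall x, Om x ->
        ((u x)%:E = \int[sigma]_(z in boundary Om) (D z x)%:E)%E}].
Proof.
split=> [j lj|]; first exact: layer_fun_mass.
(* Fubini asks for a sigma-finite structure. [sigma] is finite, hence equal as a set function to a
   measure that carries one. *)
have [mu muE] : exists mu : {sigma_finite_measure set 'rV[R]_m.+1 -> \bar R},
    mu = sigma :> (set _ -> \bar R).
  apply: sigma_finite_measureP; exists (fun=> setT); first by rewrite bigcup_const.
  by move=> _; split => //; exact: surface_lty hOm hsigma.
have hmu : surface_measure Om mu.
  split; first by case: hsigma => <- _; rewrite -muE.
  by move=> c r Q phi ch B mB Bc; rewrite -(hsigma.2 _ _ _ _ ch B mB Bc) -muE.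
rewrite -muE; exists (ustar Om D mu); split.
- exact: (ustar_L1loc hOm hmu hG hD).
- exact: (ustar_weak_cvg hOm hmu hG hD).
- exact: (ustar_dual hOm hmu hG hD).
- exact: (ustarE hOm hmu hG hD).
Qed.
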